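(* For any Lie groupoid $\mathcal{G}\rightrightarrows M$, $H^0_{\mathrm{def}}(\mathcal{G})\cong H^0(\mathcal{G},\mathfrak{i})=\Gamma(\mathfrak{i})^{\mathrm{inv}}$.
   Context: For a Lie groupoid $\mathcal{G}\rightrightarrows M$ with source $s$, target $t$, inversion $i$, write $g:x\to y$ for $x=s(g)$, $y=t(g)$. The Lie algebroid $A$ has fibres $A_x=T_{1_x}s^{-1}(x)$ and anchor $\rho=dt|_A:A\to TM$. For $g:x\to y$, $r_g$ and $l_g$ are the differentials of right translation $s^{-1}(y)\to s^{-1}(x)$ and left translation $t^{-1}(x)\to t^{-1}(y)$. For $\alpha\in\Gamma(A)$ put $\overrightarrow{\alpha}(g)=r_g\alpha_{t(g)}$ and $\overleftarrow{\alpha}(g)=l_g(di(\alpha_{s(g)}))$. The deformation cohomology $H^*_{\mathrm{def}}(\mathcal{G})$ is the cohomology of a cochain complex $C^*_{\mathrm{def}}(\mathcal{G})$ in degrees $\ge 0$ with $C^0_{\mathrm{def}}(\mathcal{G})=\Gamma(A)$, $C^1_{\mathrm{def}}(\mathcal{G})$ the space of $s$-projectable vector fields on $\mathcal{G}$, and differential $\delta:C^0_{\mathrm{def}}(\mathcal{G})\to C^1_{\mathrm{def}}(\mathcal{G})$ given by $\delta(\alpha)=\overrightarrow{\alpha}+\overleftarrow{\alpha}$; so $H^0_{\mathrm{def}}(\mathcal{G})=\ker(\delta|_{\Gamma(A)})$. $\mathfrak{i}_x=\ker(\rho_x)$ is the Lie algebra of the isotropy group $\mathcal{G}_x$; for $g:x\to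 y$, $ad_g:\mathfrak{i}_x\to\mathfrak{i}_y$ is the differential at the unit of conjugation by $g$; $\Gamma(\mathfrak{i})=\ker(\rho:\Gamma(A)\to\Gamma(TM))$, and by definition $H^0(\mathcal{G},\mathfrak{i})=\Gamma(\mathfrak{i})^{\mathrm{inv}}=\{\alpha\in\Gamma(\mathfrak{i}): ad_g(\alpha(x))=\alpha(y)\ \text{for all } g:x\to y \text{ in }\mathcal{G}\}$. ($\mathcal{G}$ is not assumed regular.) *)

(* Defs.v *)
From HB Require Import structures.
From mathcomp Require Import all_boot all_order all_algebra.
From mathcomp Require Import ring.
From mathcomp Require Import all_classical all_reals all_analysis.

Set Implicit Arguments.
Unset Strict Implicit.
Unset Printing Implicit Defensive.

Import Order.TTheory GRing.Theory Num.Theory.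
Import numFieldNormedType.Exports.

Local Open Scope classical_set_scope.
Local Open Scope ring_scope.

(* C^k and C^oo maps on an open subset U of a finite-dimensional V: all the
   iterated directional derivatives of order <= k exist and are continuous. *)
Fixpoint Ck (R : realType) (V W : normedModType R) (k : nat) (U : set V)
    (f : V -> W) : Prop :=
  (forall x, U x -> {for x, continuous f}) /\
  if k is k'.+1 then
    forall v, (forall x, U x -> derivable f x v) /\ Ck k' U (fun x => 'D_v f x)
  else True.

Definition smooth_on (R : realType) (V W : normedModType R) (U : set V)
    (f : V -> W) : Prop :=
  forall k, Ck k U f.

Definition smooth_near (R : realType) (V W : normedModType R) (x : V)
    (f : V -> W) : Prop :=
  exists U : set V, [/\ open U, U x & smooth_on U f].

(* A chart is defined on [cdom]; the values of [cfwd] outside [cdom], and of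
   [cbwd] outside the image of [cdom], are irrelevant. *)
Record chart (X V : Type) := Chart {
  cdom : set X;
  cfwd : X -> V;
  cbwd : V -> X }.

Definition is_chart (R : realType) (X : topologicalType) (V : normedModType R)
    (c : chart X V) : Prop :=
  [/\ open (cdom c),
      open (cfwd c @` cdom c),
      (forall p, cdom c p -> cbwd c (cfwd c p) = p),
      (forall p, cdom c p -> {for p, continuous (cfwd c)}) &
      (forall y, (cfwd c @` cdom c) y -> {for y, continuous (cbwd c)})].

Definition is_atlas (R : realType) (X : topologicalType) (V : normedModType R)
    (A : set (chart X V)) : Prop :=
  [/\ (forall c, A c -> is_chart c),
      (forall p, exists2 c, A c & cdom c p) &
      (forall c d, A c -> A d ->
        smooth_on (cfwd c @` (cdom c `&` cdom d)) (cfwd d \o cbwd c))].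

(* Smooth manifolds modelled on R^n.  The separation axioms are not included:
   they are imposed where they are needed (see [lie_groupoid]). *)
Record manifold (R : realType) (n : nat) := Manifold {
  carrier :> topologicalType;
  atlas : set (chart carrier 'rV[R]_n);
  atlasP : is_atlas atlas }.

Arguments atlas {R n} m.

(* The product charts c x d, which form an atlas of X x Y modelled on V x W. *)
Definition prod_atlas (X V Y W : Type) (A : set (chart X V))
    (B : set (chart Y W)) : set (chart (X * Y)%type (V * W)%type) :=
  [set e | exists c d, [/\ A c, B d &
    e = Chart (cdom c `*` cdom d)
              (fun z => (cfwd c z.1, cfwd d z.2))
              (fun w => (cbwd c w.1, cbwd d w.2))]].

(* [smooth_at A S p phi]: near p, phi restricts to a smooth function on the
   subset S of the manifold (X, A), for the smooth structure that S inherits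
   from X: phi coincides on S, near p, with a smooth function on X.  For an
   embedded submanifold S this is smoothness for its manifold structure.  Only
   the germ at p of phi on S matters. *)
Definition smooth_at (R : realType) (X : topologicalType)
    (V : normedModType R) (A : set (chart X V)) (S : set X) (p : X)
    (phi : X -> R) : Prop :=
  exists F : X -> R,
    (forall c, A c -> cdom c p -> smooth_near (cfwd c p) (F \o cbwd c)) /\
    (\forall q \near p, S q -> phi q = F q).

(* f, restricted to S, is a smooth map into the manifold (Y, B) near p. *)
Definition smooth_map_at (R : realType) (X Y : topologicalType)
    (V W : normedModType R) (A : set (chart X V)) (S : set X)
    (B : set (chart Y W)) (f : X -> Y) (p : X) : Prop :=
  f @ within S (nbhs p) --> f p /\
  forall phi : Y -> R, smooth_at B setT (f p) phi -> smooth_at A S p (phi \o f).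

Definition smooth_map (R : realType) (X Y : topologicalType)
    (V W : normedModType R) (A : set (chart X V)) (S : set X)
    (B : set (chart Y W)) (f : X -> Y) : Prop :=
  forall p, S p -> smooth_map_at A S B f p.

Definition functional (R : realType) (X : Type) : Type := (X -> R) -> R.

HB.instance Definition _ (R : realType) (X : Type) :=
  GRing.Lmodule.copy (functional R X) ((X -> R) -> R).

(* T_p S: the derivations at p of the algebra of germs at p of smooth functions
   on S.  A derivation is represented by a functional on all functions, with
   value 0 on those that are not smooth at p. *)
Definition tangent (R : realType) (X : topologicalType) (V : normedModType R)
    (A : set (chart X V)) (S : set X) (p : X) : set (functional R X) :=
  [set v | [/\ (forall phi, ~ smooth_at A S p phi -> v phi = 0),
      (forall phi psi, smooth_at A S p phi ->
        (\forall q \near p, S q -> phi q = psi q) -> v phi = v psi),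
      (forall (a : R) phi psi,
        smooth_at A S p phi -> smooth_at A S p psi ->
        v (fun q => a * phi q + psi q) = a * v phi + v psi) &
      (forall phi psi, smooth_at A S p phi -> smooth_at A S p psi ->
        v (fun q => phi q * psi q) = v phi * psi p + phi p * v psi)]].

(* The differential T_p S -> T_q S' of a map f : S -> S' with f p = q, as the
   pushforward of derivations. *)
Definition dmap (R : realType) (X : Type) (Y : topologicalType)
    (W : normedModType R) (B : set (chart Y W)) (S' : set Y) (q : Y)
    (f : X -> Y) (v : functional R X) : functional R Y :=
  fun phi => if `[< smooth_at B S' q phi >] then v (phi \o f) else 0.

Section SmoothLinear.
Variables (R : realType) (V W : normedModType R).
Implicit Types (U : set V) (f g : V -> W).

Lemma Ck_ext (k : nat) U f g : open U ->
  (forall x, U x -> f x = g x) -> Ck k U f -> Ck k U g.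
Proof.
move=> oU; elim: k f g => [|k IH] f g fg [cf df].
all: have nfg x (Ux : U x) : \forall y \near x, f y = g y
  by apply: filterS (open_nbhs_nbhs (conj oU Ux)) => y; exact: fg.
all: have cg x (Ux : U x) : {for x, continuous g}
  by move: (cf x Ux); rewrite /prop_for /continuous_at (fg _ Ux);
     apply: cvg_trans;
     apply: near_eq_cvg; apply: filterS (nfg x Ux) => y ->.
all: split=> // v; have [df1 df2] := df v; split=> [x Ux|].
  exact: near_eq_derivable (nfg x Ux) (df1 x Ux).
by apply: IH df2 => x Ux; apply: near_eq_derive; exact: nfg.
Qed.

Lemma Ck_lin (k : nat) U (a : R) f g : open U ->
  Ck k U f -> Ck k U g -> Ck k U (a \*: f + g).
Proof.
move=> oU; elim: k f g => [|k IH] f g [cf df] [cg dg].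
all: have cfg x (Ux : U x) : {for x, continuous (a \*: f + g)}
  by apply: cvgD (cg x Ux); apply: cvgZr; exact: cf.
all: split=> // v; have [df1 df2] := df v; have [dg1 dg2] := dg v.
split=> [x Ux|].
  by apply: derivableD (dg1 x Ux); apply: derivableZ (df1 x Ux).
apply: Ck_ext (IH _ _ df2 dg2) => // x Ux.
by rewrite deriveD ?deriveZ//; [exact: df1|apply: derivableZ; exact: df1
  |exact: dg1].
Qed.

Lemma Ck_cst (k : nat) U (w : W) : open U -> Ck k U (cst w).
Proof.
move=> oU; elim: k w => [|k IH] w;
  (split; first by move=> x _; exact: cvg_cst) => //.
move=> v; split=> [x _|]; first exact: derivable_cst.
by apply: (@Ck_ext _ _ (cst 0)) => // x _; rewrite derive_cst.
Qed.

Lemma Ck_sub (k : nat) U U' f : U' `<=` U -> Ck k U f -> Ck k U' f.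
Proof.
move=> sU; elim: k f => [|k IH] f [cf df];
  (split; first by move=> x /sU; exact: cf) => // v.
have [df1 df2] := df v; split; last exact: IH.
by move=> x /sU; exact: df1.
Qed.

Lemma smooth_near_lin x (a : R) f g :
  smooth_near x f -> smooth_near x g -> smooth_near x (a \*: f + g).
Proof.
move=> [U [oU Ux sf]] [U' [oU' Ux' sg]]; exists (U `&` U').
split=> [|//|k]; first exact: openI.
apply: Ck_lin; first exact: openI.
- by apply: Ck_sub (sf k) => y [].
- by apply: Ck_sub (sg k) => y [].
Qed.

End SmoothLinear.

Section SmoothAtLinear.
Variables (R : realType) (X : topologicalType) (V : normedModType R).
Variables (A : set (chart X V)) (S : set X) (p : X).

Lemma smooth_at_cst (a : R) : smooth_at A S p (cst a).
Proof.
exists (cst a); split=> [c _ _|]; last by near=> q.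
by exists setT; split=> //; [exact: openT|move=> k; exact/Ck_cst/openT].
Unshelve. all: by end_near. Qed.

Lemma smooth_at_lin (a : R) (phi psi : X -> R) :
  smooth_at A S p phi -> smooth_at A S p psi ->
  smooth_at A S p (fun q => a * phi q + psi q).
Proof.
move=> [F [sF eF]] [H [sH eH]]; exists (fun q => a * F q + H q); split.
  by move=> c Ac cp; apply: smooth_near_lin; [exact: sF|exact: sH].
by near=> q => Sq; rewrite (near eF q)// (near eH q).
Unshelve. all: by end_near. Qed.

Lemma functional_lin (a : R) (v w : functional R X) (phi : X -> R) :
  (a *: v + w) phi = a * v phi + w phi.
Proof. by []. Qed.

Lemma tangent0 : tangent A S p (0 : functional R X).
Proof.
have v0 phi : (0 : functional R X) phi = 0 by [].
by split=> *; rewrite !v0 ?mulr0 ?mul0r ?addr0.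
Qed.

Lemma tangent_lin (a : R) (v w : functional R X) :
  tangent A S p v -> tangent A S p w -> tangent A S p (a *: v + w).
Proof.
move=> [v0 vg vl vm] [w0 wg wl wm]; split.
- by move=> phi n; rewrite functional_lin v0// w0// mulr0 addr0.
- by move=> phi psi sphi e; rewrite !functional_lin (vg _ psi)// (wg _ psi).
- move=> b phi psi sphi spsi; rewrite !functional_lin vl// wl//; ring.
- move=> phi psi sphi spsi; rewrite !functional_lin vm// wm//; ring.
Qed.

End SmoothAtLinear.

Section DmapLinear.
Variables (R : realType) (X : Type) (Y : topologicalType).
Variables (W : normedModType R) (B : set (chart Y W)) (S' : set Y) (q : Y).

Lemma dmap0 (f : X -> Y) : dmap B S' q f 0 = 0.
Proof. by apply/funext => phi; rewrite /dmap; case: asboolP. Qed.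

Lemma dmap_lin (f : X -> Y) (a : R) (v w : functional R X) :
  dmap B S' q f (a *: v + w) = a *: dmap B S' q f v + dmap B S' q f w.
Proof.
apply/funext => phi; rewrite functional_lin /dmap; case: asboolP => _ //.
by rewrite mulr0 addr0.
Qed.

End DmapLinear.

(* [mul_ h g] is the composite hg, meaningful when [src h = tgt g].  As is usual
   for Lie groupoids, the base is a Hausdorff and second countable manifold,
   whereas no such condition is required of the space of arrows. *)
Record lie_groupoid (R : realType) (n k : nat) := LieGroupoid {
  base : manifold R n;
  arrow : manifold R k;
  src : arrow -> base;
  tgt : arrow -> base;
  unit_ : base -> arrow;
  inv_ : arrow -> arrow;
  mul_ : arrow -> arrow -> arrow;
  base_hausdorff : hausdorff_space base;
  base_second_countable : @second_countable base;
  src_unit : forall x, src (unit_ x) = x;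
  tgt_unit : forall x, tgt (unit_ x) = x;
  src_mul : forall h g, src h = tgt g -> src (mul_ h g) = src g;
  tgt_mul : forall h g, src h = tgt g -> tgt (mul_ h g) = tgt h;
  mulA : forall h g f, src h = tgt g -> src g = tgt f ->
    mul_ h (mul_ g f) = mul_ (mul_ h g) f;
  mul_unitl : forall g, mul_ (unit_ (tgt g)) g = g;
  mul_unitr : forall g, mul_ g (unit_ (src g)) = g;
  src_inv : forall g, src (inv_ g) = tgt g;
  tgt_inv : forall g, tgt (inv_ g) = src g;
  mul_invl : forall g, mul_ (inv_ g) g = unit_ (src g);
  mul_invr : forall g, mul_ g (inv_ g) = unit_ (tgt g);
  src_smooth : smooth_map (atlas arrow) setT (atlas base) src;
  tgt_smooth : smooth_map (atlas arrow) setT (atlas base) tgt;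
  unit_smooth : smooth_map (atlas base) setT (atlas arrow) unit_;
  inv_smooth : smooth_map (atlas arrow) setT (atlas arrow) inv_;
  mul_smooth :
    smooth_map (prod_atlas (atlas arrow) (atlas arrow))
               [set z | src z.1 = tgt z.2]
               (atlas arrow) (fun z => mul_ z.1 z.2);
  src_submersion : forall g w, tangent (atlas base) setT (src g) w ->
    exists2 v, tangent (atlas arrow) setT g v
             & dmap (atlas base) setT (src g) src v = w;
  tgt_submersion : forall g w, tangent (atlas base) setT (tgt g) w ->
    exists2 v, tangent (atlas arrow) setT g v
             & dmap (atlas base) setT (tgt g) tgt v = w }.

Section LieGroupoid.
Variables (R : realType) (n k : nat) (G : lie_groupoid R n k).

Local Notation M := (base G).
Local Notation Ar := (arrow G).
Local Notation AM := (atlas (base G)).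
Local Notation AG := (atlas (arrow G)).
Local Notation s := (@src R n k G).
Local Notation t := (@tgt R n k G).
Local Notation u := (@unit_ R n k G).
Local Notation inv := (@inv_ R n k G).
Local Notation mul := (@mul_ R n k G).

Definition sfiber (x : M) : set Ar := [set h | s h = x].
Definition tfiber (x : M) : set Ar := [set h | t h = x].
Definition isotropy (x : M) : set Ar := [set h | s h = x /\ t h = x].

Definition algebroid (x : M) : set (functional R Ar) :=
  tangent AG (sfiber x) (u x).

Definition anchor (x : M) (v : functional R Ar) : functional R M :=
  dmap AM setT x t v.

(* r_g : T_(1_y) s^-1(y) -> T_g s^-1(x) and l_g : T_(1_x) t^-1(x) -> T_g t^-1(y)
   for g : x -> y. *)
Definition rtrans (g : Ar) (v : functional R Ar) : functional R Ar :=
  dmap AG (sfiber (s g)) g (fun h => mul h g) v.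

Definition ltrans (g : Ar) (v : functional R Ar) : functional R Ar :=
  dmap AG (tfiber (t g)) g (fun h => mul g h) v.

(* di : T_(1_x) s^-1(x) -> T_(1_x) t^-1(x). *)
Definition d_inv (x : M) (v : functional R Ar) : functional R Ar :=
  dmap AG (tfiber x) (u x) inv v.

Definition sections : Type := M -> functional R Ar.

HB.instance Definition _ := GRing.Lmodule.copy sections (M -> functional R Ar).

(* Gamma(A).  As a vector bundle, A is the subbundle ker(ds) of the pullback of
   TG along the unit map, so a section of A is smooth iff it is smooth as a
   vector field along the unit map, i.e. iff it maps smooth functions on (open
   subsets of) G to smooth functions on M. *)
Definition algebroid_section (alpha : sections) : Prop :=
  (forall x, algebroid x (alpha x)) /\
  (forall x phi, smooth_at AG setT (u x) phi ->
     smooth_at AM setT x (fun y => alpha y phi)).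

Definition right_vf (alpha : sections) (g : Ar) : functional R Ar :=
  rtrans g (alpha (t g)).

Definition left_vf (alpha : sections) (g : Ar) : functional R Ar :=
  ltrans g (d_inv (s g) (alpha (s g))).

(* The sum is taken in T_g G, which contains T_g s^-1(s g) and T_g t^-1(t g) via
   the differentials of the inclusions.  The values of delta are s-projectable
   vector fields; its kernel does not depend on the choice of the codomain. *)
Definition to_TG (g : Ar) (v : functional R Ar) : functional R Ar :=
  dmap AG setT g id v.

Definition delta (alpha : sections) : Ar -> functional R Ar :=
  fun g => to_TG g (right_vf alpha g) + to_TG g (left_vf alpha g).

(* H^0_def(G), the kernel of delta on C^0_def(G) = Gamma(A). *)
Definition H0def_pred (alpha : sections) : bool :=
  `[< algebroid_section alpha /\ delta alpha = 0 >].

Definition isotropy_algebra (x : M) : set (functional R Ar) :=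
  tangent AG (isotropy x) (u x).

(* The differential T_(1_x) G_x -> A_x of the inclusion of the isotropy group
   G_x in s^-1(x); it identifies T_(1_x) G_x with the kernel of the anchor. *)
Definition isotropy_incl (x : M) (v : functional R Ar) : functional R Ar :=
  dmap AG (sfiber x) (u x) id v.

(* The differential T_(1_x) G_x -> T_(1_y) G_y of h |-> g h g^-1, g : x -> y. *)
Definition dconj (g : Ar) (v : functional R Ar) : functional R Ar :=
  dmap AG (isotropy (t g)) (u (t g)) (fun h => mul (mul g h) (inv g)) v.

(* [is_ad g xi eta]: ad_g xi = eta, for xi in ker(rho_x) and eta in ker(rho_y),
   where ad_g is [dconj g] read through the identifications [isotropy_incl]. *)
Definition is_ad (g : Ar) (xi eta : functional R Ar) : Prop :=
  exists v, [/\ isotropy_algebra (s g) v, isotropy_incl (s g) v = xi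
    & isotropy_incl (t g) (dconj g v) = eta].

(* Gamma(i), the kernel of the anchor on sections. *)
Definition isotropy_section (alpha : sections) : Prop :=
  algebroid_section alpha /\ (forall x, anchor x (alpha x) = 0).

(* H^0(G, i) = Gamma(i)^inv. *)
Definition H0isotropy_pred (alpha : sections) : bool :=
  `[< isotropy_section alpha /\
      (forall g, is_ad g (alpha (s g)) (alpha (t g))) >].

End LieGroupoid.

Section Cohomology.
Variables (R : realType) (n k : nat) (G : lie_groupoid R n k).
Implicit Types alpha beta : sections G.

Lemma sections_lin (a : R) alpha beta x :
  (a *: alpha + beta) x = a *: alpha x + beta x.
Proof. by []. Qed.

Lemma algebroid_section0 : algebroid_section (0 : sections G).
Proof.
split=> [x|x phi _].
  exact: tangent0.
exact: (@smooth_at_cst _ _ _ _ _ _ 0).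
Qed.

Lemma algebroid_section_lin (a : R) alpha beta :
  algebroid_section alpha -> algebroid_section beta ->
  algebroid_section (a *: alpha + beta).
Proof.
move=> [ta sa] [tb sb]; split=> [x|x phi sphi].
  exact: (tangent_lin a (ta x) (tb x)).
exact: (smooth_at_lin a (sa x phi sphi) (sb x phi sphi)).
Qed.

Lemma deltaE alpha g : delta alpha g =
  to_TG g (rtrans g (alpha (tgt g))) +
  to_TG g (ltrans g (d_inv (src g) (alpha (src g)))).
Proof. by []. Qed.

Lemma delta0 : delta (0 : sections G) = 0.
Proof.
apply/funext => g; rewrite deltaE.
have e x : (0 : sections G) x = 0 by [].
by rewrite !e /rtrans /ltrans /d_inv /to_TG !dmap0 addr0.
Qed.

Lemma delta_lin (a : R) alpha beta :
  delta (a *: alpha + beta) = a *: delta alpha + delta beta.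
Proof.
apply/funext => g; rewrite deltaE !sections_lin.
rewrite /rtrans /ltrans /d_inv /to_TG !dmap_lin.
by rewrite addrACA -scalerDr.
Qed.

Lemma H0def_submod : GRing.submod_closed (@H0def_pred R n k G).
Proof.
split=> [|a alpha beta].
  by apply/asboolP; split; [exact: algebroid_section0|exact: delta0].
move=> /asboolP[sa da] /asboolP[sb db]; apply/asboolP; split.
  exact: algebroid_section_lin.
by rewrite delta_lin da db scaler0 addr0.
Qed.

Lemma H0isotropy_submod : GRing.submod_closed (@H0isotropy_pred R n k G).
Proof.
split=> [|a alpha beta].
  apply/asboolP; split; [split; first exact: algebroid_section0|].
    by move=> x; exact: dmap0.
  move=> g; exists 0; rewrite /isotropy_incl /dconj !dmap0.
  by split=> //; exact: tangent0.
move=> /asboolP[[sa ra] ia] /asboolP[[sb rb] ib]; apply/asboolP; split.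
  split; first exact: algebroid_section_lin.
  move=> x; rewrite sections_lin /anchor dmap_lin.
  by rewrite -!/(anchor _ _) ra rb scaler0 addr0.
move=> g; have [v [tv iv cv]] := ia g; have [w [tw iw cw]] := ib g.
exists (a *: v + w); split; first exact: tangent_lin.
- by rewrite /isotropy_incl dmap_lin -!/(isotropy_incl _ _) iv iw.
- rewrite /isotropy_incl /dconj !dmap_lin.
  by rewrite -!/(dconj _ _) -!/(isotropy_incl _ _) cv cw.
Qed.

HB.instance Definition _ :=
  GRing.isSubmodClosed.Build R (sections G) (@H0def_pred R n k G) H0def_submod.
HB.instance Definition _ :=
  GRing.isSubmodClosed.Build R (sections G) (@H0isotropy_pred R n k G)
    H0isotropy_submod.

Record H0def := MkH0def { H0def_val :> sections G; _ : H0def_pred H0def_val }.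
HB.instance Definition _ := [isSub for H0def_val].
HB.instance Definition _ := [Choice of H0def by <:].
HB.instance Definition _ := [SubChoice_isSubLmodule of H0def by <:].

Record H0isotropy := MkH0isotropy {
  H0isotropy_val :> sections G; _ : H0isotropy_pred H0isotropy_val }.
HB.instance Definition _ := [isSub for H0isotropy_val].
HB.instance Definition _ := [Choice of H0isotropy by <:].
HB.instance Definition _ := [SubChoice_isSubLmodule of H0isotropy by <:].

End Cohomology.

(* Main.v *)
(* Applying dt to delta(alpha) = 0 at the units shows that alpha is a section of
   ker(rho); then delta(alpha)(g) = 0 says that r_g alpha = - l_g (di alpha),
   which, as inversion is -1 on the Lie algebra of an isotropy group, is the
   invariance of alpha under Ad_g.

   The delicate point is that ker(rho_x) is, in terms of derivations, the Lie
   algebra of the isotropy group G_x, which is not known to be a submanifold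
   here: alpha(x) has to kill every smooth function vanishing on G_x.  Since
   rho(alpha) = 0 everywhere, the right-invariant vector field of alpha is
   tangent to the fibres of (s, t).  A limit of its Euler polygons starting at
   1_x is a point of G_x that agrees with 1_x + h alpha(x) up to o(h), so that
   alpha(x) is tangent to G_x; neither a flow nor a constant rank theorem is
   needed.  Derivations are compared with directional derivatives in charts by
   Hadamard's lemma. *)
Require Import Defs.
From HB Require Import structures.
From mathcomp Require Import all_boot all_order all_algebra.
From mathcomp Require Import ring lra.
From mathcomp Require Import all_classical all_reals all_analysis.

Set Implicit Arguments.
Unset Strict Implicit.
Unset Printing Implicit Defensive.

Import Order.TTheory GRing.Theory Num.Theory.
Import numFieldNormedType.Exports.

Local Open Scope classical_set_scope.
Local Open Scope ring_scope.

(** * Calculus in normed modules *)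

(** Multiplication lives on the composable pairs, in general not an open subset of the square of the
    arrow space, and the fibres of [src] and [tgt] and the isotropy groups carry no charts of their
    own. Smoothness on each of these sets means local extension to the ambient manifold, so every
    derivative is computed on an extension, in an ambient chart, and carried back by equality of
    germs on the subset.

    For the tangency of alpha(x) to G_x, the vanishing of the anchor is used at all points near x,
    since the Euler polygons move away from 1_x. They do not stay in the source fibre of x either,
    hence the right-invariant field is regarded as a field on the whole arrow space; the coordinates
    of s and of t enter on the same footing, as functions that this field annihilates, and only the
    limit of the polygons returns to their common level set. *)

Section LineCalculus.
Context {R : realType}.
Implicit Types V W : normedModType R.

(** The two difference quotients are the same function of h. Restriction to a line, slices of
    functions on a product and changes of linear coordinates are all instances. *)
Lemma derive_affine V V' W (L : V' -> V) (c : V) (f : V -> W) x v :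
  linear L ->
  (derivable (fun y => f (L y + c)) x v <-> derivable f (L x + c) (L v)) /\
  'D_v (fun y => f (L y + c)) x = 'D_(L v) f (L x + c).
Proof.
move=> lL.
have e : (fun h : R => h^-1 *: (f (L (h *: v + x) + c) - f (L x + c))) =
         (fun h : R => h^-1 *: (f (h *: L v + (L x + c)) - f (L x + c))).
  by apply/funext => h; rewrite lL addrA.
by split; rewrite /derivable /derive /= e.
Qed.

Lemma is_derive_line V W (f : V -> W) x v (h : R) : derivable f (x + h *: v) v ->
  is_derive h 1 (fun k => f (x + k *: v)) ('D_v f (x + h *: v)).
Proof.
move=> df.
have lL : linear (fun k : R => k *: v).
  by move=> a y z; rewrite scalerDl -scalerA.
have e : (fun k => f (x + k *: v)) = (fun k => f (k *: v + x)).
  by apply/funext => k; rewrite addrC.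
have [d1 d2] := derive_affine x f h 1 lL.
rewrite scale1r addrC in d1 d2; rewrite e.
by split; [exact/d1|exact/d2].
Qed.

(** Along the line through x in direction v, f is a function of one real variable, for which
    derivability is differentiability; its differential is linear, which covers a = 0 as well. *)
Lemma derivable_deriveZ V W (f : V -> W) x v (a : R) : derivable f x v ->
  derivable f x (a *: v) /\ 'D_(a *: v) f x = a *: 'D_v f x.
Proof.
move=> df; have lL : linear (fun k : R => k *: v).
  by move=> b y z; rewrite scalerDl -scalerA.
have [d1 d2] := derive_affine x f 0 a lL.
have [_ e2] := derive_affine x f 0 (1 : R) lL.
rewrite scale0r add0r scale1r in d1 d2 e2.
have dg : derivable (fun y : R => f (y *: v + x)) 0 1.
  have [e1 _] := derive_affine x f 0 (1 : R) lL.
  by rewrite scale0r add0r scale1r in e1; apply/e1.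
have dg' : differentiable (fun y : R => f (y *: v + x)) 0.
  exact/derivable1_diffP.
split; first by apply/d1; apply: diff_derivable.
rewrite -d2 -e2 !deriveE//.
by rewrite -[in LHS](mulr1 a) -[a * 1]/(a *: (1 : R^o)) linearZ.
Qed.

Lemma is_derive_from_line V W (f : V -> W) x v l :
  derivable (fun e : R => f (x + e *: v)) 0 1 ->
  (fun e : R => f (x + e *: v))^`()%classic 0 = l -> is_derive x v f l.
Proof.
move=> k1 k2; have lL : linear (fun k : R => k *: v).
  by move=> a b c; rewrite scalerDl -scalerA.
have [e1 e2] := derive_affine x f 0 (1 : R) lL.
rewrite scale0r add0r scale1r in e1 e2.
have E : (fun e : R => f (x + e *: v)) = (fun e : R => f (e *: v + x)).
  by apply/funext => e; rewrite addrC.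
by rewrite E in k1 k2; split; [exact/e1|rewrite -e2 -derive1E].
Qed.

Lemma mean_value V (f : V -> R) x v :
  (forall h : R, 0 <= h <= 1 -> derivable f (x + h *: v) v) ->
  exists2 h : R, 0 <= h <= 1 & f (x + v) - f x = 'D_v f (x + h *: v).
Proof.
move=> df.
have dg (h : R) : h \in `[0, 1]%R ->
    is_derive h (1 : R) (fun k => f (x + k *: v)) ('D_v f (x + h *: v)).
  by rewrite in_itv /= => h01; apply: is_derive_line; exact: df.
pose g (k : R) : R := f (x + k *: v).
pose g' (k : R) : R := 'D_v f (x + k *: v).
have i1 (h : R) : h \in `]0, 1[%R -> is_derive h (1 : R) g (g' h).
  by move=> /subset_itv_oo_cc; exact: dg.
have i2 : {within `[0, 1], continuous g}.
  by apply: derivable_within_continuous => h h01; have [] := dg h h01.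
have [h h01 e] := MVT_segment ler01 i1 i2.
exists h; first by rewrite in_itv /= in h01.
by move: e; rewrite /g scale1r scale0r addr0 subr0 mulr1.
Qed.

End LineCalculus.

Lemma Ck1_sub {R : realType} (V W : normedModType R) k U (f : V -> W) :
  Ck k.+1 U f -> Ck k U f.
Proof.
elim: k f => [|k IH] f [cf df]; split=> // v.
have [d1 d2] := df v; split=> //; exact: IH.
Qed.

Lemma continuous_sumr {R : realType} (T : topologicalType) (I : Type)
    (r : seq I) (f : I -> T -> R) (x : T) :
  (forall i, {for x, continuous (f i)}) ->
  {for x, continuous (fun y => \sum_(i <- r) f i y)}.
Proof. by move=> cf; apply: (cvg_big add_continuous) => i _; exact: cf. Qed.

(** * Linearity of directional derivatives and differentiability of C^1 functions *)

Section C1.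
Context {R : realType}.

(** The increment from x to x + h(v + w) is split at x + hv. The first part gives 'D_v f x; by the
    mean value theorem the second is h times a derivative along w at a point that tends to x, and
    this derivative is continuous. *)
Lemma deriveDr (V : normedModType R) (U : set V) (f : V -> R) x v w :
  open U -> U x -> Ck 1 U f -> 'D_(v + w) f x = 'D_v f x + 'D_w f x.
Proof.
move=> oU Ux [_ df].
have [dv _] := df v; have [dvw _] := df (v + w).
have [dw [cw _]] := df w.
pose A h := h^-1 *: (f (h *: (v + w) + x) - f (h *: v + x)).
suff cA : A h @[h --> 0^'] --> 'D_w f x.
  apply: cvg_lim => //.
  have -> : (fun h => h^-1 *: ((f \o shift x) (h *: (v + w)) - f x)) =
            (fun h => h^-1 *: ((f \o shift x) (h *: v) - f x)) \+ A.
    apply/funext => h; rewrite /A /= -scalerDr; congr (_ *: _).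
    by rewrite [RHS]addrC addrA subrK.
  exact: (cvgD (dv x Ux) cA).
apply/cvgrPdist_le => e e0.
have /cvgrPdist_le/(_ e e0) Dw := cw x Ux.
have /nbhs_ballP[d /= d0 dP] : \forall y \near x,
    U y /\ `|'D_w f x - 'D_w f y| <= e.
  by near=> y; split; near: y; [exact: open_nbhs_nbhs|exact: Dw].
(* For t in [0, 1] the point x + hv + thw is within |h|(|v| + |w|) of x, so |h| < d / C keeps it in
   the ball of radius d; the 1 makes C positive. *)
pose C := `|v| + `|w| + 1.
have C0 : 0 < C by rewrite ltr_wpDl// addr_ge0.
near=> h.
have h0 : h != 0 by near: h; exact: nbhs_dnbhs_neq.
have hd : `|h| < d / C by near: h; apply: dnbhs0_lt; rewrite divr_gt0.
have B (t : R) : 0 <= t <= 1 -> ball x d ((h *: v + x) + t *: (h *: w)).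
  move=> /andP[t0 t1]; rewrite -ball_normE /= addrAC opprD addrA addrC.
  rewrite addKr normrN.
  rewrite (le_lt_trans (ler_normD _ _))// !normrZ (ger0_norm t0).
  rewrite ltr_pdivlMr// in hd; apply: le_lt_trans hd.
  rewrite /C mulrDr mulr1 mulrDr -addrA lerD2l ler_wpDr//.
  by rewrite ler_piMl// mulr_ge0.
have [t /B Bt e1] : exists2 t : R, 0 <= t <= 1 &
    f ((h *: v + x) + h *: w) - f (h *: v + x) =
    'D_(h *: w) f ((h *: v + x) + t *: (h *: w)).
  apply: mean_value => t /B /dP[Ut _].
  by have [] := derivable_deriveZ h (dw _ Ut).
have [Ut le_e] := dP _ Bt.
rewrite /A (_ : h *: (v + w) + x = h *: v + x + h *: w); last first.
  by rewrite scalerDr addrAC.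
rewrite e1 (derivable_deriveZ h (dw _ Ut)).2.
by rewrite scalerK.
Unshelve. all: by end_near. Qed.

Lemma deriveZr (V : normedModType R) (U : set V) (f : V -> R) x v a :
  open U -> U x -> Ck 1 U f -> 'D_(a *: v) f x = a * 'D_v f x.
Proof.
by move=> oU Ux [_ df]; have [/(_ x Ux) dv _] := df v;
  rewrite (derivable_deriveZ a dv).2.
Qed.

Lemma derive_rowE m (U : set 'rV[R]_m) (f : 'rV[R]_m -> R) x v :
  open U -> U x -> Ck 1 U f ->
  'D_v f x = \sum_j v 0 j * 'D_(delta_mx 0 j) f x.
Proof.
move=> oU Ux Cf; rewrite [v in 'D_v f x]row_sum_delta.
elim/big_rec2: _ => [|j a b _ <-]; first by rewrite derive0.
by rewrite (deriveDr _ _ oU Ux Cf) (deriveZr _ _ oU Ux Cf).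
Qed.

Lemma C1_mean_value (V : normedModType R) (U : set V) (f : V -> R) x v :
  Ck 1 U f -> (forall h : R, 0 <= h <= 1 -> U (x + h *: v)) ->
  exists2 h : R, 0 <= h <= 1 & f (x + v) - f x = 'D_v f (x + h *: v).
Proof.
by move=> [_ df] HU; apply: mean_value => h /HU; have [d _] := df v; exact: d.
Qed.

(** The candidate differential is v |-> 'D_v f x. The remainder is a difference of derivatives along
    w at x and at a point of the segment, small by continuity of the partial derivatives. This gives
    access to the chain rule for differentiable maps. *)
Lemma differentiable_C1 m (U : set 'rV[R]_m) (f : 'rV[R]_m -> R) x :
  open U -> U x -> Ck 1 U f -> differentiable f x.
Proof.
move=> oU Ux Cf; have [_ df] := Cf.
have lin : linear (fun v => 'D_v f x).
  by move=> a v w; rewrite (deriveDr _ _ oU Ux Cf) (deriveZr _ _ oU Ux Cf).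
pose Lmix := GRing.isLinear.Build _ _ _ _ _ lin.
pose L : {linear 'rV[R]_m -> R^o} := HB.pack (fun v => 'D_v f x) Lmix.
have LE v : L v = \sum_j v 0 j * 'D_(delta_mx 0 j) f x.
  exact: derive_rowE oU Ux Cf.
have cL : continuous L.
  rewrite (_ : (L : _ -> _) = fun v => \sum_j v 0 j * 'D_(delta_mx 0 j) f x).
    move=> v; apply: continuous_sumr => j.
    by apply: continuousM; [exact: coord_continuous|exact: cst_continuous].
  exact/funext/LE.
suff E : (f : 'rV[R]_m -> R^o) \o shift x =
    cst (f x : R^o) + L +o_ (0 : 'rV[R]_m) id.
  have e := diff_unique cL E.
  by apply/diff_locallyP; rewrite e; split.
apply/eqaddoP => _/posnumP[e].
(* Each of the m coordinates contributes at most |w| e / C, and m / C <= 1. *)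
pose C : R := m%:R + 1.
have C0 : 0 < C by rewrite ltr_wpDl.
have /nbhs_ballP[d /= d0 dP] : \forall y \near x, U y /\ forall j,
    `|'D_(delta_mx 0 j) f x - 'D_(delta_mx 0 j) f y| <= e%:num / C.
  near=> y; split; first by near: y; exact: open_nbhs_nbhs.
  near: y; apply: filter_forall => j.
  have [_ [/(_ x Ux)/cvgrPdist_le + _]] := df (delta_mx 0 j).
  by apply; rewrite divr_gt0.
have nw : \forall w \near (0 : 'rV[R]_m), `|w| < d by exact: nbhs0_lt.
near=> w.
have wd : `|w| < d by near: w; exact: nw.
have B (h : R) : 0 <= h <= 1 -> ball x d (x + h *: w).
  move=> /andP[h0 h1]; rewrite -ball_normE /= opprD addNKr normrN normrZ.
  by rewrite ger0_norm// (le_lt_trans _ wd)// ler_piMl.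
have [h /B Bh e1] : exists2 h : R, 0 <= h <= 1 &
    f (x + w) - f x = 'D_w f (x + h *: w).
  by apply: (C1_mean_value Cf) => h /B /dP[].
have [Ut le_e] := dP _ Bh.
rewrite !fctE /= [w + x]addrC opprD addrA e1.
rewrite (derive_rowE _ oU Ut Cf) (derive_rowE _ oU Ux Cf) -sumrB.
rewrite (le_trans (ler_norm_sum _ _ _))//.
apply: (@le_trans _ _ (\sum_(j < m) `|w| * (e%:num / C))).
  apply: ler_sum => j _; rewrite -mulrBr normrM ler_pM//.
    rewrite [leRHS]mx_normrE; exact: (le_bigmax _ _ (0, j)).
  by rewrite distrC.
rewrite sumr_const card_ord -mulr_natl mulrCA mulrC -mulrA.
by rewrite mulrA ler_wpM2r// mulrCA ler_piMr// ler_pdivrMr// mul1r lerDl.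
Unshelve. all: by end_near. Qed.

End C1.

(** * Products, sums and composites of C^k functions *)

Section SmoothCalculus.
Context {R : realType}.
Implicit Types V W : normedModType R.

Lemma Ck_mul V k (U : set V) (f g : V -> R) : open U ->
  Ck k U f -> Ck k U g -> Ck k U (fun x => f x * g x).
Proof.
move=> oU; elim: k f g => [|k IH] f g Cf Cg; have [cf df] := Cf;
  have [cg dg] := Cg.
  by split=> // x Ux; apply: continuousM; [exact: cf|exact: cg].
split=> [x Ux|v]; first by apply: continuousM; [exact: cf|exact: cg].
have [df1 df2] := df v; have [dg1 dg2] := dg v; split=> [x Ux|].
  by apply: derivableM; [exact: df1|exact: dg1].
apply: (@Ck_ext _ _ _ _ _ (1 \*: (fun x => f x * 'D_v g x) +
                           (fun x => g x * 'D_v f x))) => //.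
  move=> x Ux; rewrite !fctE /= scale1r.
  by have -> := deriveM (df1 x Ux) (dg1 x Ux).
apply: Ck_lin => //; apply: IH => //; exact: Ck1_sub.
Qed.

Lemma Ck_sum V k (U : set V) (I : Type) (r : seq I) (f : I -> V -> R) :
  open U -> (forall i, Ck k U (f i)) -> Ck k U (fun x => \sum_(i <- r) f i x).
Proof.
move=> oU Cf; elim: r => [|i r IH].
  apply: (@Ck_ext _ _ _ _ _ (cst 0)) => //; last exact: Ck_cst.
  by move=> x _; rewrite big_nil.
apply: (@Ck_ext _ _ _ _ _ (1 \*: f i + (fun x => \sum_(i <- r) f i x))) => //.
  by move=> x _; rewrite big_cons !fctE /= scale1r.
exact: Ck_lin.
Qed.

(** A derivative of y |-> f (L y + c) is again a derivative of f composed with the same affine map,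
    so the induction closes. *)
Lemma Ck_affine V V' W k (U : set V) (L : V' -> V) (c : V) (f : V -> W) :
  linear L -> continuous L ->
  Ck k U f -> Ck k [set y | U (L y + c)] (fun y => f (L y + c)).
Proof.
move=> lL cL; elim: k f => [|k IH] f [cf df];
  (split=> [x Ux|];
  first by apply: (@continuous_comp _ _ _ (fun y => L y + c) f);
    [apply: cvgD; [exact: cL|exact: cvg_cst]|exact: cf]) => // v.
have [df1 df2] := df (L v); split=> [x Ux|].
  by apply/(derive_affine c f x v lL).1; exact: df1.
have -> : 'D_v (fun y => f (L y + c)) = (fun x => 'D_(L v) f (L x + c)).
  by apply/funext => x; rewrite (derive_affine c f x v lL).2.
exact: (IH (fun z => 'D_(L v) f z) df2).
Qed.

Lemma Ck_coord V m k (U : set V) (g : V -> 'rV[R]_m) j : open U ->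
  Ck k U g -> Ck k U (fun y => g y 0 j).
Proof.
move=> oU; elim: k g => [|k IH] g [cg dg];
  (split=> [x Ux|];
  first by apply: (@continuous_comp _ _ _ g (fun y : 'rV[R]_m => y 0 j));
   [exact: cg|exact: coord_continuous]) => // v.
have [dg1 dg2] := dg v; split=> [x Ux|].
  by have /derivable_mxP := dg1 x Ux; exact.
apply: Ck_ext (IH _ dg2) => // x Ux.
by rewrite derive_mx ?mxE//; exact: dg1.
Qed.

(** Restricted to the line through x in direction v, g becomes a differentiable curve, even if g is
    only known to be derivable along v; the chain rule is applied to f and this curve. *)
Lemma is_derive_comp_row V m (g : V -> 'rV[R]_m) (f : 'rV[R]_m -> R) x v :
  differentiable f (g x) -> (forall j, derivable (fun y => g y 0 j) x v) ->
  is_derive x v (f \o g) ('D_(\row_j 'D_v (fun y => g y 0 j) x) f (g x)).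
Proof.
move=> df dg.
have dgv : derivable g x v.
  by apply/derivable_mxP => i j; rewrite ord1; exact: dg.
have lL : linear (fun k : R => k *: v).
  by move=> b y z; rewrite scalerDl -scalerA.
have [g1 g2] := derive_affine x g 0 (1 : R) lL.
have [h1 h2] := derive_affine x (f \o g) 0 (1 : R) lL.
rewrite scale0r add0r scale1r in g1 g2 h1 h2.
pose G (k : R) := g (k *: v + x).
have dG : differentiable G 0 by apply/derivable1_diffP/g1.
have G0 : G 0 = g x by rewrite /G scale0r add0r.
have dfG : differentiable f (G 0) by rewrite G0.
have dF : differentiable (f \o G) 0 by exact: differentiable_comp.
split; first by apply/h1/derivable1_diffP.
rewrite -h2 -[LHS]/('D_1 (f \o G) 0) deriveE// diff_comp//= G0.
rewrite -(deriveE _ df) -(deriveE _ dG) -[X in 'D_X f _]/('D_1 G 0) g2.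
suff -> : 'D_v g x = \row_j 'D_v (fun y => g y 0 j) x by [].
by rewrite (derive_mx dgv); apply/rowP => j; rewrite !mxE.
Qed.

Lemma continuous_rowP (T : topologicalType) m (g : T -> 'rV[R]_m) (x : T) :
  (forall j, {for x, continuous (fun y => g y 0 j)}) -> {for x, continuous g}.
Proof.
move=> cg; apply/cvgrPdist_le => e e0; near=> y.
rewrite [leLHS]mx_normrE; apply: bigmax_le => [|[i j] _]; first exact: ltW.
rewrite !mxE ord1 /=; move: j; near: y; apply: filter_forall => j.
have /cvgrPdist_le := cg j; exact.
Unshelve. all: by end_near. Qed.

(** Induction on k: by the chain rule a derivative of f o g is a sum of products of a derivative of
    a coordinate of g with a partial derivative of f composed with g. *)
Lemma Ck_comp V m k (U : set V) (U' : set 'rV[R]_m) (g : V -> 'rV[R]_m)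
    (f : 'rV[R]_m -> R) :
  open U -> open U' -> (forall x, U x -> U' (g x)) ->
  (forall j, Ck k U (fun y => g y 0 j)) -> Ck k U' f -> Ck k U (f \o g).
Proof.
move=> oU oU' UU'; elim: k f => [|k IH] f Cg Cf.
all: have cfg x (Ux : U x) : {for x, continuous (f \o g)}
  by apply: continuous_comp; [apply: continuous_rowP => j;
    have [+ _] := Cg j; exact|have [+ _] := Cf; apply; exact: UU'].
all: split=> // v.
have C1f : Ck 1 U' f.
  have [c1 d1] := Cf; split=> // w; have [d2 d3] := d1 w; split=> //.
  by case: (k) d3 => [|k'] [c3 _].
have isd x (Ux : U x) : is_derive x v (f \o g)
    ('D_(\row_j 'D_v (fun y => g y 0 j) x) f (g x)).
  apply: is_derive_comp_row; first exact: differentiable_C1 oU' (UU' _ Ux) C1f.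
  by move=> j; have [_ /(_ v)[+ _]] := Cg j; exact.
split=> [x /isd[]//|].
apply: (@Ck_ext _ _ _ _ _ (fun x => \sum_(j < m)
    'D_v (fun y => g y 0 j) x * 'D_(delta_mx 0 j) f (g x))) => //.
  move=> x Ux; have [_ ->] := isd x Ux.
  rewrite (derive_rowE _ oU' (UU' _ Ux) C1f); apply: eq_bigr => j _.
  by rewrite mxE.
apply: Ck_sum => // j; apply: Ck_mul => //.
  by have [_ /(_ v)[]] := Cg j.
apply: (IH (fun z => 'D_(delta_mx 0 j) f z)) => [i|]; first exact: Ck1_sub.
by have [_ /(_ (delta_mx 0 j))[]] := Cf.
Qed.

End SmoothCalculus.

Lemma near_lipschitz_continuous {R : realType} (V : normedModType R)
    (f : V -> R) (x : V) (L : R) : 0 <= L ->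
  (\forall y \near x, `|f x - f y| <= L * `|x - y|) -> {for x, continuous f}.
Proof.
move=> L0 fL; apply/cvgrPdist_le => e e0; near=> y.
have xy : `|x - y| < e / (L + 1).
  near: y; apply: (@cvgr_dist_lt _ _ _ _ _ id x) => //.
  by rewrite divr_gt0// ltr_wpDl.
apply: le_trans (near fL y _) _ => //.
rewrite ltr_pdivlMr ?ltr_wpDl// in xy; apply: le_trans (ltW xy).
by rewrite mulrC ler_wpM2l// lerDl.
Unshelve. all: by end_near. Qed.

(** * Uniform bounds, Lipschitz and Taylor estimates on closed balls *)

Section Estimates.
Context {R : realType} {m : nat}.
Implicit Types (f : 'rV[R]_m -> R) (x y z w : 'rV[R]_m) (r : R).

Lemma normr_coord_le w j : `|w 0 j| <= `|w|.
Proof. by rewrite [leRHS]mx_normrE; exact: (le_bigmax _ _ (0, j)). Qed.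

Lemma segment_norm_le x r y z (h : R) :
  `|x - y| <= r -> `|x - z| <= r -> 0 <= h <= 1 ->
  `|x - (y + h *: (z - y))| <= r.
Proof.
move=> xy xz /andP[h0 h1].
have -> : x - (y + h *: (z - y)) = (1 - h) *: (x - y) + h *: (x - z).
  by apply/rowP => j; rewrite !mxE; ring.
rewrite (le_trans (ler_normD _ _))// !normrZ ger0_norm ?subr_ge0//.
rewrite (ger0_norm h0) (_ : r = (1 - h) * r + h * r); last by ring.
by rewrite lerD// ler_wpM2l// subr_ge0.
Qed.

Lemma closed_ball_compact x r : compact [set y | `|x - y| <= r].
Proof.
apply: bounded_closed_compact.
  exists (`|x| + r); split; first exact: num_real.
  move=> M ltM y /= xy; apply: le_trans (ltW ltM).
  rewrite -(subKr x y) -[y in leLHS]opprK; rewrite (le_trans (ler_normB _ _))//.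
  by rewrite opprK lerD2l.
have -> : [set y | `|x - y| <= r] = (fun y => `|x - y|) @^-1` [set t | t <= r].
  by [].
apply: closed_comp; last exact: closed_le.
move=> y _; apply: (@continuous_comp _ _ _ (fun y => x - y) (fun z => `|z|)).
  by apply: continuousB; [exact: cst_continuous|move=> ?].
exact: norm_continuous.
Qed.

Lemma continuous_bounded_closed_ball f x r r' : r' < r ->
  (forall y, ball x r y -> {for y, continuous f}) ->
  exists2 M : R, 0 <= M & forall y, `|x - y| <= r' -> `|f y| <= M.
Proof.
move=> rr cf; set B := [set y | `|x - y| <= r'].
have : compact (f @` B).
  apply: continuous_compact; last exact: closed_ball_compact.
  apply: continuous_in_subspaceT => y /set_mem yB; apply: cf.
  by rewrite -ball_normE /=; exact: le_lt_trans rr.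
move=> /compact_bounded[M [_ HM]].
exists (`|M| + 1); first by rewrite addr_ge0.
move=> y yB; apply: (HM (`|M| + 1)); last by exists y.
by rewrite (le_lt_trans (ler_norm M))// ltrDl.
Qed.

Lemma derive_bounded_closed_ball f x r r' : r' < r -> Ck 1 (ball x r) f ->
  exists2 L : R, 0 <= L &
    forall y w, `|x - y| <= r' -> `|'D_w f y| <= L * `|w|.
Proof.
move=> rr Cf; have [_ df] := Cf.
have H (j : 'I_m) : exists M : R, 0 <= M /\
    forall y, `|x - y| <= r' -> `|'D_(delta_mx 0 j) f y| <= M.
  have [_ [c _]] := df (delta_mx 0 j).
  by have [M M0 HM] := continuous_bounded_closed_ball rr c; exists M.
have [M HM] := choice H.
exists (\sum_j M j); first by apply: sumr_ge0 => j _; have [] := HM j.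
move=> y w yr; have yB : ball x r y.
  by rewrite -ball_normE /=; exact: le_lt_trans rr.
rewrite (derive_rowE _ (ball_open _ _) yB Cf) (le_trans (ler_norm_sum _ _ _))//.
rewrite mulr_suml ler_sum// => j _; rewrite normrM mulrC ler_pM//.
  by have [_] := HM j; exact.
exact: normr_coord_le.
Qed.

Lemma lipschitz_closed_ball f x r r' : r' < r -> Ck 1 (ball x r) f ->
  exists2 L : R, 0 <= L & forall y z, `|x - y| <= r' -> `|x - z| <= r' ->
    `|f z - f y| <= L * `|z - y|.
Proof.
move=> rr Cf; have [L L0 HL] := derive_bounded_closed_ball rr Cf.
exists L => // y z xy xz.
have [|h h01] := C1_mean_value (x := y) (v := z - y) Cf.
  move=> h h01; rewrite -ball_normE /=; apply: le_lt_trans rr.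
  exact: segment_norm_le.
rewrite subrKC => ->; apply: HL; exact: segment_norm_le.
Qed.

(** The mean value theorem turns the increment into a derivative along z - y at a point of the
    segment; the partial derivatives are Lipschitz, and moving that point to y costs a second factor
    |z - y|. *)
Lemma taylor2_closed_ball f x r r' : r' < r -> Ck 2 (ball x r) f ->
  exists2 K : R, 0 <= K & forall y z, `|x - y| <= r' -> `|x - z| <= r' ->
    `|f z - f y - 'D_(z - y) f y| <= K * `|z - y| ^+ 2.
Proof.
move=> rr C2f; have Cf := Ck1_sub C2f; have [_ df] := C2f.
have H (j : 'I_m) : exists L : R, 0 <= L /\ forall y z, `|x - y| <= r' ->
    `|x - z| <= r' -> `|'D_(delta_mx 0 j) f z - 'D_(delta_mx 0 j) f y| <=
      L * `|z - y|.
  have [_ Cj] := df (delta_mx 0 j).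
  by have [M M0 HM] := lipschitz_closed_ball rr Cj; exists M.
have [L HL] := choice H.
have inB y : `|x - y| <= r' -> ball x r y.
  by move=> xy; rewrite -ball_normE /=; exact: le_lt_trans rr.
exists (\sum_j L j); first by apply: sumr_ge0 => j _; have [] := HL j.
move=> y z xy xz.
have [|h h01] := C1_mean_value (x := y) (v := z - y) Cf.
  by move=> h h01; apply: inB; exact: segment_norm_le.
have xh := segment_norm_le xy xz h01.
rewrite subrKC => ->; rewrite !(derive_rowE _ (ball_open _ _) (inB _ _) Cf)//.
rewrite -sumrB (le_trans (ler_norm_sum _ _ _))// mulr_suml ler_sum// => j _.
rewrite -mulrBr normrM expr2 mulrA mulrC ler_pM ?normr_coord_le//.
have [L0 /(_ _ _ xy xh) H1] := HL j; apply: le_trans H1 _.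
rewrite ler_wpM2l// addrAC subrr add0r normrZ.
by move: h01 => /andP[h0 h1]; rewrite ger0_norm// ler_piMl.
Qed.

End Estimates.

(** * Hadamard's lemma *)

Section Hadamard.
Context {R : realType} {m : nat}.
Variables (p : 'rV[R]_m) (r : R).
Implicit Types (H : 'rV[R]_m -> R) (x y v : 'rV[R]_m).

Local Notation B := (ball p r).
Local Notation mu := (@lebesgue_measure R).

Let seg x (t : R) := p + t *: (x - p).

(** The Hadamard coefficients are the case n = 0 with H a partial derivative. Differentiating H(p +
    t(x - p)) in x brings out a factor t, so the weights t^n make the family closed under
    differentiation. *)
Definition ray_mean (n : nat) H x : R :=
  \int[mu]_(t in `[0, 1]) (t ^+ n * H (seg x t)).

Lemma seg_norm x (t : R) : 0 <= t <= 1 -> `|p - seg x t| <= `|p - x|.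
Proof.
move=> /andP[t0 t1]; rewrite /seg opprD addNKr normrN normrZ ger0_norm//.
by rewrite distrC ler_piMl.
Qed.

Lemma seg_ball x (t : R) : B x -> 0 <= t <= 1 -> B (seg x t).
Proof.
by rewrite -!ball_normE /= => xr t01; exact: le_lt_trans (seg_norm _ t01) xr.
Qed.

Lemma seg_continuous x : continuous (seg x).
Proof.
move=> t; apply: cvgD; first exact: cvg_cst.
by apply: cvgZr_tmp; exact: cvg_id.
Qed.

Lemma ray_within_continuous n H x : (forall y, B y -> {for y, continuous H}) ->
  B x -> {within `[0%R, 1%R], continuous (fun t : R => t ^+ n * H (seg x t))}.
Proof.
move=> cH Bx; apply: continuous_in_subspaceT => t /set_mem /=.
rewrite in_itv /= => t01.
apply: (@cvgM R _ _ _ (fun t : R => t ^+ n) (fun t => H (seg x t))).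
  exact: exprn_continuous.
apply: (@continuous_comp _ _ _ (seg x) H); first exact: seg_continuous.
by apply: cH; exact: seg_ball.
Qed.

Lemma ray_integrable n H x : (forall y, B y -> {for y, continuous H}) ->
  B x -> mu.-integrable `[0, 1] (EFin \o (fun t => t ^+ n * H (seg x t))).
Proof.
move=> cH Bx; apply: continuous_compact_integrable.
  exact: segment_compact.
exact: ray_within_continuous.
Qed.

Lemma Rintegral_itv01_cst (c : R) : \int[mu]_(t in `[0%R, 1%R]) c = c.
Proof.
by rewrite Rintegral_cst//= lebesgue_measure_itv /= lte_fin ltr01 oppr0 addr0
  mulr1.
Qed.

Lemma ray_mean_center H : ray_mean 0 H p = H p.
Proof.
rewrite /ray_mean -[RHS]Rintegral_itv01_cst; apply: eq_Rintegral => t _.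
by rewrite expr0 mul1r /seg subrr scaler0 addr0.
Qed.


Lemma is_derive_ray n H v x : (forall y, B y -> {for y, continuous H}) ->
  (forall y, B y -> derivable H y v) ->
  (forall y, B y -> {for y, continuous (fun z => 'D_v H z)}) -> B x ->
  is_derive x v (ray_mean n H) (ray_mean n.+1 (fun z => 'D_v H z) x).
Proof.
move=> cH dH cdH Bx.
pose f (e : R) (t : R) : R := t ^+ n * H (seg (x + e *: v) t).
have xr : `|p - x| < r by move: Bx; rewrite -ball_normE.
(* A closed ball of radius r' < r contains x, and also x + e v for |e| < d. On it 'D_v H is bounded
   by a constant M, which dominates the differentiated integrand uniformly in e and t. *)
pose r' := (`|p - x| + r) / 2.
have [xr' rr'] : `|p - x| < r' /\ r' < r by rewrite /r'; split; lra.
pose d := (r' - `|p - x|) / (`|v| + 1).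
have v1 : 0 < `|v| + 1 by rewrite ltr_wpDl.
have d0 : 0 < d by rewrite divr_gt0// subr_gt0.
have near_x (e : R) : `]-d, d[%classic e -> `|p - (x + e *: v)| <= r'.
  rewrite /= in_itv /= -ltr_norml => ed; rewrite opprD addrA.
  rewrite (le_trans (ler_normB _ _))// normrZ -lerBrDl.
  rewrite (@le_trans _ _ (d * (`|v| + 1)))//; last by rewrite /d divfK// gt_eqF.
  by apply: ler_pM => //; [exact: ltW|rewrite lerDl].
have BI (e : R) : `]-d, d[%classic e -> B (x + e *: v).
  by move=> /near_x xe; rewrite -ball_normE /=; exact: le_lt_trans rr'.
have Bseg (e t : R) : `]-d, d[%classic e -> `[0, 1]%classic t ->
    B (seg (x + e *: v) t).
  by move=> /BI Be; rewrite /= in_itv /=; exact: seg_ball.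
have df (e t : R) : `]-d, d[%classic e -> `[0, 1]%classic t ->
    is_derive e (1 : R) (f ^~ t)
      (t ^+ n.+1 * 'D_v H (seg (x + e *: v) t)).
  move=> Ie It; have By := Bseg _ _ Ie It.
  have lL : linear (fun e : R => e *: (t *: v)).
    by move=> a b c; rewrite scalerDl -scalerA.
  have [e1 e2] := derive_affine (p + t *: (x - p)) H e (1 : R) lL.
  have sE (k : R) : k *: (t *: v) + (p + t *: (x - p)) = seg (x + k *: v) t.
    by rewrite /seg; apply/rowP => j; rewrite !mxE; ring.
  rewrite scale1r sE in e1 e2.
  have [e3 e4] := derivable_deriveZ t (dH _ By).
  have -> : f ^~ t = t ^+ n \*:
      (fun k : R => H (k *: (t *: v) + (p + t *: (x - p)))).
    by apply/funext => k; rewrite /f /= sE.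
  apply: is_derive_eq.
    by apply: is_deriveZ; apply: DeriveDef; [exact/e1|exact: e2].
  by rewrite e4 exprSr -mulrA.
have [M M0 HM] := continuous_bounded_closed_ball rr' cdH.
have I0 : `]-d, d[%classic (0 : R) by rewrite /= in_itv /= oppr_lt0 d0.
have d1f (e t : R) : `]-d, d[%classic e -> `[0, 1]%classic t ->
    partial1of2 f e t = t ^+ n.+1 * 'D_v H (seg (x + e *: v) t).
  by move=> Ie It; rewrite partial1of2E; have [_ ->] := df e t Ie It.
have key : derivable (fun e : R => ray_mean n H (x + e *: v)) 0 1 /\
    (fun e : R => ray_mean n H (x + e *: v))^`()%classic 0 =
      ray_mean n.+1 (fun z => 'D_v H z) x.
  have h1 (e : R) : `]-d, d[%classic e ->
    mu.-integrable `[0, 1] (EFin \o f e) by move=> /BI; exact: ray_integrable.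
  have h2 (e t : R) : `]-d, d[%classic e -> `[0, 1]%classic t ->
    derivable (f ^~ t) e 1 by move=> Ie It; have [] := df e t Ie It.
  have h3 : mu.-integrable `[0, 1] (EFin \o cst M).
    by apply: continuous_compact_integrable; [exact: segment_compact|
      apply: continuous_subspaceT => t; exact: cvg_cst].
  have h4 (e t : R) : `]-d, d[%classic e -> `[0, 1]%classic t ->
    `|partial1of2 f e t| <= cst M t.
    move=> Ie It; rewrite d1f// normrM /=.
    have It' : 0 <= t <= 1 by move: It; rewrite /= in_itv.
    have /andP[t0 t1] := It'.
    rewrite -[M]mul1r ler_pM//.
      by rewrite ger0_norm ?exprn_ge0// exprn_ile1.
    by apply: HM; exact: le_trans (seg_norm _ It') (near_x _ Ie).
  have mI : measurable (`[0%R, 1%R]%classic : set (measurableTypeR R)) by [].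
  split.
    exact: (derivable_under_integral mI I0 h1 h2 (fun=> M0) h3 h4).
  rewrite (differentiation_under_integral mI I0 h1 h2 (fun=> M0) h3 h4).
  apply: eq_Rintegral => t /set_mem It.
  by rewrite d1f// scale0r addr0.
by have [k1 k2] := key; exact: is_derive_from_line.
Qed.

(** A Lipschitz bound for H on a smaller closed ball holds uniformly in t and passes through the
    integral. *)
Lemma continuous_ray n H x : Ck 1 B H -> B x ->
  {for x, continuous (ray_mean n H)}.
Proof.
move=> CH Bx; have [cH _] := CH.
have xr : `|p - x| < r by move: Bx; rewrite -ball_normE.
pose r' := (`|p - x| + r) / 2.
have [xr' rr'] : `|p - x| < r' /\ r' < r by rewrite /r'; split; lra.
have [L L0 HL] := lipschitz_closed_ball rr' CH.
have Bx' : ball p r' x by rewrite -ball_normE.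
apply: (near_lipschitz_continuous L0); near=> y.
have By : ball p r' y.
  by near: y; apply: open_nbhs_nbhs; split => //; exact: ball_open.
have py : `|p - y| <= r' by move: By; rewrite -ball_normE /= => /ltW.
have By' : B y by rewrite -ball_normE /=; exact: le_lt_trans rr'.
have ix := ray_integrable n cH Bx; have iy := ray_integrable n cH By'.
have mI : measurable (`[0%R, 1%R]%classic : set (measurableTypeR R)) by [].
rewrite /ray_mean -RintegralB//.
rewrite (le_trans (le_normr_Rintegral _ _))//.
  exact: (integrableB mI ix iy).
rewrite -[leRHS]Rintegral_itv01_cst; apply: le_Rintegral => //.
- exact: (integrable_norm (integrableB mI ix iy)).
- by apply: continuous_compact_integrable; [exact: segment_compact|
      apply: continuous_subspaceT => t; exact: cvg_cst].
move=> t; rewrite /= in_itv /= => t01; have /andP[t0 t1] := t01.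
rewrite -mulrBr normrM -[leRHS]mul1r ler_pM//.
  by rewrite ger0_norm ?exprn_ge0// exprn_ile1.
apply: le_trans (HL _ _ _ _) _.
- exact: le_trans (seg_norm _ t01) _.
- exact: le_trans (seg_norm _ t01) (ltW _).
rewrite /seg opprD addrACA subrr add0r -scalerBr opprB subrKA.
by rewrite normrZ ger0_norm// ler_wpM2l// ler_piMl.
Unshelve. all: by end_near. Qed.

(** One order of differentiability is spent on the Lipschitz bound of [continuous_ray]; for smooth
    functions this loss is harmless. *)
Lemma Ck_ray k n H : Ck k.+1 B H -> Ck k B (ray_mean n H).
Proof.
elim: k n H => [|k IH] n H CH.
  by split=> // x; exact: continuous_ray.
have C1H : Ck 1 B H by elim: (k) CH => [|k' IHk] /Ck1_sub.
have [cH dH] := CH; split=> [x|v]; first exact: continuous_ray.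
have [dv Cv] := dH v.
have isd x (Bx : B x) := is_derive_ray n cH dv (fun y By => (proj1 Cv) y By) Bx.
split=> [x /isd[]//|].
apply: Ck_ext (IH n.+1 _ Cv); first exact: ball_open.
by move=> x /isd[_ ->].
Qed.

End Hadamard.

Section HadamardLemma.
Context {R : realType}.

Lemma Rintegral_sum (d : measure_display) (T : measurableType d)
    (mu : {measure set T -> \bar R}) (D : set T) (I : Type) (r : seq I)
    (h : I -> T -> R) : measurable D ->
  (forall i, mu.-integrable D (EFin \o h i)) ->
  \int[mu]_(t in D) (\sum_(i <- r) h i t) =
  \sum_(i <- r) \int[mu]_(t in D) h i t.
Proof.
move=> mD ih.
suff [] : mu.-integrable D (EFin \o (fun t => \sum_(i <- r) h i t)) /\
  \int[mu]_(t in D) (\sum_(i <- r) h i t) =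
  \sum_(i <- r) \int[mu]_(t in D) h i t by [].
elim: r => [|i r [IH1 IH2]].
  rewrite big_nil; split.
    rewrite (_ : EFin \o _ = cst 0%E); last first.
      by apply/funext => t /=; rewrite big_nil.
    exact: integrable0.
  under eq_Rintegral do rewrite big_nil.
  by rewrite /Rintegral integral0.
rewrite big_cons -IH2 -RintegralD//; split; last first.
  by apply: eq_Rintegral => t _; rewrite big_cons.
rewrite (_ : EFin \o _ =
  (fun t => (h i t)%:E + (\sum_(j <- r) h j t)%:E)%E); last first.
  by apply/funext => t /=; rewrite big_cons.
exact: (integrableD mD (ih i) IH1).
Qed.

Lemma smooth_near_ball (V W : normedModType R) (f : V -> W) (p : V) :
  smooth_near p f -> exists2 r : R, 0 < r & smooth_on (ball p r) f.
Proof.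
move=> [U [oU Up sf]].
have /nbhs_ballP[r r0 rU] : nbhs p U by exact: open_nbhs_nbhs.
by exists r => // k; apply: Ck_sub (sf k).
Qed.

(** The fundamental theorem of calculus along the segment from p to x, with the derivative along x -
    p expanded into partial derivatives under the integral. *)
Lemma hadamard m (f : 'rV[R]_m -> R) p : smooth_near p f ->
  exists g : 'I_m -> 'rV[R]_m -> R, [/\ forall j, smooth_near p (g j),
    forall j, g j p = 'D_(delta_mx 0 j) f p &
    \forall x \near p, f x = f p + \sum_j (x 0 j - p 0 j) * g j x].
Proof.
move=> /smooth_near_ball[r r0 sf].
have [cf df] := sf 1.
have Cj j k : Ck k (ball p r) (fun z => 'D_(delta_mx 0 j) f z).
  by have [_ /(_ (delta_mx 0 j))[]] := sf k.+1.
exists (fun j => ray_mean p 0 (fun z => 'D_(delta_mx 0 j) f z)).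
split=> [j|j|]; last 1 first.
- have : \forall x \near p, ball p r x by apply: nbhsx_ballx.
  apply: filterS => x Bx.
  pose F (t : R) := f (p + t *: (x - p)).
  pose f' (t : R) := 'D_(x - p) f (p + t *: (x - p)).
  have F1 (t : R) : 0 <= t <= 1 -> is_derive t (1 : R) F (f' t).
    move=> t01; apply: is_derive_line; have [+ _] := df (x - p); apply.
    exact: (seg_ball Bx t01).
  have F1c (t : R) : 0 <= t <= 1 -> {for t, continuous F}.
    move=> /F1[+ _] => /derivable1_diffP; exact: differentiable_continuous.
  have cD y : ball p r y -> {for y, continuous (fun z => 'D_(x - p) f z)}.
    by have [_ [+ _]] := df (x - p); exact.
  have cf' : {within `[0, 1], continuous f'}.
    have := ray_within_continuous (n := 0) cD Bx.
    rewrite (_ : (fun t => _) = f')//; apply/funext => t.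
    by rewrite expr0 mul1r.
  have FLR : derivable_oo_LRcontinuous F 0 1.
    split.
    - move=> t /subset_itv_oo_cc; rewrite in_itv /= => t01.
      by have [] := F1 t t01.
    - by apply: cvg_at_right_filter; apply: F1c; rewrite lexx ler01.
    - by apply: cvg_at_left_filter; apply: F1c; rewrite lexx ler01.
  have Ff' : {in `]0, 1[, F^`()%classic =1 f'}.
    move=> t /subset_itv_oo_cc; rewrite in_itv /= => t01.
    by rewrite derive1E; have [_ ->] := F1 t t01.
  have := continuous_FTC2 ltr01 cf' FLR Ff'.
  rewrite /F scale1r scale0r addr0 subrKC -EFinB => /(congr1 fine) /= e.
  apply/eqP; rewrite addrC -subr_eq; apply/eqP; rewrite -{}e.
  transitivity (\int[lebesgue_measure]_(t in `[0%R, 1%R]) \sum_(j < m)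
      (x 0 j - p 0 j) * (t ^+ 0 * 'D_(delta_mx 0 j) f (p + t *: (x - p)))).
    apply: eq_Rintegral => t /set_mem /=; rewrite in_itv /= => t01.
    rewrite /f' (derive_rowE _ (ball_open _ _) (seg_ball Bx t01) (sf 1)).
    by apply: eq_bigr => j _; rewrite !mxE expr0 mul1r.
  have cj j y : ball p r y ->
    {for y, continuous (fun z => 'D_(delta_mx 0 j) f z)}.
    by have [+ _] := Cj j 0; exact.
  rewrite Rintegral_sum//; last first.
    move=> j.
    by have := integrableZl _ (x 0 j - p 0 j) (ray_integrable 0 (cj j) Bx); apply.
  apply: eq_bigr => j _; rewrite RintegralZl//.
  exact: (ray_integrable 0 (cj j) Bx).
- exists (ball p r); split; [exact: ball_open|exact: ballxx|].
  by move=> k; exact: Ck_ray.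
- exact: ray_mean_center.
Qed.

End HadamardLemma.

(** * Euler polygons *)

Section EulerPolygons.
Context {R : realType} {m : nat} {I : finType}.
Variables (W : 'rV[R]_m -> 'rV[R]_m) (f : I -> 'rV[R]_m -> R).
Variables (y0 : 'rV[R]_m) (rho omega : R) (K : I -> R).

Let C := `|W y0| + omega.
Let B (y : 'rV[R]_m) := `|y0 - y| <= rho.

Hypothesis omega_ge0 : 0 <= omega.
Hypothesis W_near : forall y, B y -> `|W y - W y0| <= omega.
Hypothesis f_cont : forall i y, B y -> {for y, continuous (f i)}.
Hypothesis f_taylor : forall i y z, B y -> B z ->
  `|f i z - f i y - 'D_(z - y) (f i) y| <= K i * `|z - y| ^+ 2.
Hypothesis f_W : forall i y (a : R), B y -> 'D_(a *: W y) (f i) y = 0.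
Hypothesis K_ge0 : forall i, 0 <= K i.

Definition euler_polygon (e : R) (l : nat) : 'rV[R]_m :=
  iter l (fun y => y + e *: W y) y0.

(** The three bounds need a common induction: the hypotheses on W and f hold only in the ball, and
    the first bound is what keeps the next vertex there. C bounds |W| on the ball, and since f has
    derivative 0 along W, a step of length at most e C changes f only by its quadratic remainder. *)
Lemma euler_polygon_bounds (e : R) (l : nat) :
  0 <= e -> l%:R * e * C <= rho ->
  [/\ `|euler_polygon e l - (y0 + (l%:R * e) *: W y0)| <= l%:R * e * omega,
      B (euler_polygon e l) &
      forall i, `|f i (euler_polygon e l) - f i y0| <=
        l%:R * (K i * (e * C) ^+ 2)].
Proof.
move=> e0; have C0 : 0 <= C by rewrite addr_ge0.
elim: l => [|l IH] lC.
  rewrite /euler_polygon /= /B !mul0r scale0r addr0 !subrr normr0; split=> //.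
    by move: lC; rewrite !mul0r.
  by move=> i; rewrite subrr normr0 mul0r.
have [|H1 H2 H3] := IH.
  by apply: le_trans lC; rewrite !ler_wpM2r// ler_nat.
set x := euler_polygon e l in H1 H2 H3.
have xS : euler_polygon e l.+1 = x + e *: W x by [].
have H1' : `|euler_polygon e l.+1 - (y0 + (l.+1%:R * e) *: W y0)| <=
    l.+1%:R * e * omega.
  rewrite xS -natr1.
  have -> : x + e *: W x - (y0 + (l%:R + 1) * e *: W y0) =
      (x - (y0 + (l%:R * e) *: W y0)) + e *: (W x - W y0).
    by apply/rowP => j; rewrite !mxE; ring.
  rewrite (le_trans (ler_normD _ _))// [leRHS](_ : _ =
    l%:R * e * omega + e * omega); last by ring.
  by rewrite lerD// normrZ ger0_norm// ler_wpM2l// W_near.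
have H2' : B (euler_polygon e l.+1).
  rewrite /B distrC; apply: le_trans lC.
  set z := euler_polygon _ _ in H1' *.
  rewrite -[z - y0](subrKA (y0 + (l.+1%:R * e) *: W y0)).
  rewrite (le_trans (ler_normD _ _))// [y0 + _ - y0]addrAC subrr add0r normrZ.
  rewrite (@ger0_norm _ (_ * e)) ?mulr_ge0// /C mulrDr addrC lerD2l.
  exact: H1'.
split=> // i.
rewrite -[_ - f i y0](subrKA (f i x)) (le_trans (ler_normD _ _))//.
rewrite -natr1 mulrDl mul1r addrC lerD//.
have := f_taylor i H2 H2'.
have zx : euler_polygon e l.+1 - x = e *: W x by rewrite xS addrAC subrr add0r.
rewrite zx f_W// subr0 => /le_trans; apply.
rewrite ler_wpM2l// ler_sqr ?nnegrE ?mulr_ge0// normrZ ger0_norm//.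
rewrite ler_wpM2l// -[W x](subrK (W y0)) (le_trans (ler_normD _ _))//.
by rewrite addrC lerD2l W_near.
Qed.

(* The Euler polygons with [N + 1] steps of size [h / (N + 1)] end at points
   where [f] has drifted by O(1 / N) only; a cluster point of these end points
   lies exactly on the level set. *)
Lemma euler_point (h : R) : 0 <= h -> h * C <= rho ->
  exists y, [/\ `|y - (y0 + h *: W y0)| <= h * omega, B y &
    forall i, f i y = f i y0].
Proof.
move=> h0 hC; have C0 : 0 <= C by rewrite addr_ge0.
pose e N : R := h / N.+1%:R.
have Ne N : N.+1%:R * e N = h by rewrite /e mulrC divfK.
have e0 N : 0 <= e N by rewrite divr_ge0.
have bnd N : N.+1%:R * e N * C <= rho by rewrite Ne.
pose p N := euler_polygon (e N) N.+1.
pose A := [set y | `|(y0 + h *: W y0) - y| <= h * omega].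
have pA N : A (p N).
  have [+ _ _] := euler_polygon_bounds (e0 N) (bnd N).
  by rewrite Ne distrC.
have [//|y [Ay cly]] := closed_ball_compact (x := y0 + h *: W y0)
  (r := h * omega) (F := p @ \oo) _.
  by exists 0%N => // N _; exact: pA.
have By : B y.
  rewrite /B -[y0 - y](subrKA (y0 + h *: W y0)).
  rewrite (le_trans (ler_normD _ _))// opprD addNKr normrN normrZ ger0_norm//.
  by apply: le_trans hC; rewrite /C mulrDr lerD2l.
exists y; split=> // [|i]; first by rewrite distrC.
apply/eqP; rewrite -subr_eq0 -normr_le0; apply/ler_addgt0Pr => eps eps0.
rewrite add0r.
have eps2 : 0 < eps / 2 by rewrite divr_gt0.
have ny : nbhs y [set z | `|f i y - f i z| <= eps / 2].
  by have /cvgrPdist_le := @f_cont i y By; apply.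
have nN : \forall N \near \oo, `|f i (p N) - f i y0| <= eps / 2.
  pose D := K i * (h * C) ^+ 2.
  have D0 : 0 <= D by rewrite mulr_ge0// exprn_ge0// mulr_ge0.
  near=> N.
  have [_ _ /(_ i) Hf] := euler_polygon_bounds (e0 N) (bnd N).
  apply: le_trans Hf _.
  have -> : N.+1%:R * (K i * (e N * C) ^+ 2) = D / N.+1%:R.
    by rewrite /D /e; field; rewrite nat1r pnatr_eq0.
  rewrite ler_pdivrMr// mulrC -ler_pdivrMr//.
  apply: ltW; apply: (@lt_le_trans _ _ N%:R); last by rewrite ler_nat.
  by near: N; exact: nbhs_infty_gtr.
(* This set contains all but finitely many of the end points, hence it meets every neighbourhood of
   the cluster point y. *)
have [z [/= H1 H2]] := cly [set z | `|f i z - f i y0| <= eps / 2] _ nN ny.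
rewrite -[_ - _](subrKA (f i z)) (le_trans (ler_normD _ _))//.
by rewrite (splitr eps) lerD.
Unshelve. all: by end_near. Qed.

End EulerPolygons.

Lemma nbhs_forall (T : topologicalType) (I : finType) (P : I -> set T) (x : T) :
  (forall i, nbhs x (P i)) -> \forall y \near x, forall i, P i y.
Proof. exact: filter_forall. Qed.

Lemma continuous_dist_le {R : realType} (T : topologicalType)
    (V : normedModType R) (W : T -> V) (y0 : T) (e : R) :
  {for y0, continuous W} -> 0 < e -> \forall y \near y0, `|W y - W y0| <= e.
Proof.
move=> cW e0; have /cvgrPdist_le/(_ e e0) := cW.
by apply: filterS => y; rewrite distrC.
Qed.

(** An Euler point y has F y = F y0 and y - y0 = h W(y0) + err with |err| <= h omega. Taylor's
    formula for F then bounds h 'D_(W y0) F y0 by a multiple of h omega plus a multiple of h^2; one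
    divides by h and lets omega and h be small. *)
Lemma derive_zero_of_level_sets {R : realType} m (I : finType)
    (W : 'rV[R]_m -> 'rV[R]_m) (f : I -> 'rV[R]_m -> R) (F : 'rV[R]_m -> R)
    (y0 : 'rV[R]_m) :
  {for y0, continuous W} -> (forall i, smooth_near y0 (f i)) ->
  smooth_near y0 F ->
  (\forall y \near y0, forall i, 'D_(W y) (f i) y = 0) ->
  (\forall y \near y0, (forall i, f i y = f i y0) -> F y = F y0) ->
  'D_(W y0) F y0 = 0.
Proof.
move=> cW sf [UF [oUF UFy sF]] fW Ff.
have [U HU] := choice sf.
have /nbhs_ballP[r /= r0 rP] : \forall y \near y0, [/\ (forall i, U i y), UF y,
    (forall i, 'D_(W y) (f i) y = 0) &
    (forall i, f i y = f i y0) -> F y = F y0].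
  have nU : \forall y \near y0, forall i, U i y.
    by apply: nbhs_forall => i; have [oU Uy _] := HU i; exact: open_nbhs_nbhs.
  have nUF : nbhs y0 UF by exact: open_nbhs_nbhs.
  by apply: filterS (filterI (filterI nU nUF) (filterI fW Ff)) =>
    y [[? ?] [? ?]].
have Cf i k : Ck k (ball y0 r) (f i).
  have [_ _ sfi] := HU i; apply: Ck_sub (sfi k) => y /rP[+ _ _ _]; exact.
have CF k : Ck k (ball y0 r) F by apply: Ck_sub (sF k) => y /rP[].
pose r' := r / 2.
have [r'0 r'r] : 0 < r' /\ r' < r by rewrite /r'; split; lra.
have inB y : `|y0 - y| <= r' -> ball y0 r y.
  by move=> yr; rewrite -ball_normE /=; exact: le_lt_trans r'r.
have HK i : exists K : R, 0 <= K /\ forall y z, `|y0 - y| <= r' ->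
    `|y0 - z| <= r' ->
    `|f i z - f i y - 'D_(z - y) (f i) y| <= K * `|z - y| ^+ 2.
  by have [K K0 HK] := taylor2_closed_ball r'r (Cf i 2); exists K.
have [K {}HK] := choice HK.
have [KF KF0 HKF] := taylor2_closed_ball r'r (CF 2).
have [LF LF0 HLF] := derive_bounded_closed_ball r'r (CF 1).
have y0r : `|y0 - y0| <= r' by rewrite subrr normr0 ltW.
apply/eqP; rewrite -normr_le0; apply/ler_addgt0Pr => eps eps0; rewrite add0r.
(* With this omega the derivative of F along err is at most h eps / 2. *)
pose omega := eps / 2 / (LF + 1).
have omega0 : 0 < omega by rewrite !divr_gt0// ltr_wpDl.
have /nbhs_ballP[d /= d0 dP] := continuous_dist_le cW omega0.
pose rho := Num.min r' (d / 2).
have rho0 : 0 < rho by rewrite lt_min r'0 divr_gt0.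
have rho_r y : `|y0 - y| <= rho -> `|y0 - y| <= r'.
  by move=> /le_trans; apply; rewrite ge_min lexx.
have rhoW y : `|y0 - y| <= rho -> `|W y - W y0| <= omega.
  move=> yr; apply: dP; rewrite -ball_normE /=; apply: le_lt_trans yr _.
  have d2 : d / 2 < d by lra.
  by rewrite /rho gt_min d2 orbT.
pose C := `|W y0| + omega.
have C0 : 0 < C by rewrite ltr_wpDl.
(* The first bound keeps the polygon in the ball of radius rho; the second makes the quadratic
   remainder KF (h C)^2 at most h eps / 2. *)
pose h := Num.min (rho / C) (eps / 2 / (KF * C ^+ 2 + 1)).
have KC0 : 0 <= KF * C ^+ 2 by rewrite mulr_ge0// exprn_ge0// ltW.
have h0 : 0 < h by rewrite lt_min !divr_gt0// ltr_wpDl.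
have hC : h * C <= rho by rewrite -ler_pdivlMr// /h ge_min lexx.
have hK : h * (KF * C ^+ 2) <= eps / 2.
  rewrite (@le_trans _ _ (h * (KF * C ^+ 2 + 1)))//.
    by apply: ler_wpM2l; [exact: ltW|rewrite lerDl].
  by rewrite -ler_pdivlMr ?ltr_wpDl// /h ge_min lexx orbT.
have [y [yh yr yf]] : exists y, [/\ `|y - (y0 + h *: W y0)| <= h * omega,
    `|y0 - y| <= rho & forall i, f i y = f i y0].
  apply: (@euler_point _ _ _ W f y0 rho omega K) => //.
  - exact: ltW.
  - move=> i y /rho_r/inB yB.
    by have [+ _] := Cf i 0; exact.
  - by move=> i y z /rho_r yB /rho_r zB; have [_] := HK i; exact.
  - move=> i y a /rho_r/inB yB.
    rewrite (deriveZr _ _ (ball_open _ _) yB (Cf i 1)).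
    by have [_ _ -> _] := rP _ yB; rewrite mulr0.
  - by move=> i; have [] := HK i.
  - exact: ltW.
have yr' := rho_r _ yr.
have FE : F y = F y0 by have [_ _ _] := rP _ (inB _ yr'); exact.
have y0B : ball y0 r y0 by exact: inB.
pose err := y - (y0 + h *: W y0).
have yE : y - y0 = h *: W y0 + err.
  by rewrite /err; apply/rowP => j; rewrite !mxE; ring.
have yC : `|y - y0| <= h * C.
  rewrite yE (le_trans (ler_normD _ _))// normrZ gtr0_norm// /C mulrDr.
  by rewrite lerD2l.
have := HKF _ _ y0r yr'; rewrite FE subrr sub0r normrN yE.
rewrite (deriveDr _ _ (ball_open _ _) y0B (CF 1)).
rewrite (deriveZr _ _ (ball_open _ _) y0B (CF 1)) -yE => H.
have H2 : `|'D_err F y0| <= h * (eps / 2).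
  apply: le_trans (HLF _ _ y0r) _.
  rewrite (@le_trans _ _ ((LF + 1) * (h * omega)))//.
    by rewrite ler_pM// lerDl.
  by rewrite /omega mulrCA ler_pM2l// mulrC divfK// gt_eqF// ltr_wpDl.
have H3 : KF * `|y - y0| ^+ 2 <= h * (eps / 2).
  apply: (@le_trans _ _ (KF * (h * C) ^+ 2)).
    rewrite ler_wpM2l// ler_sqr ?nnegrE// mulr_ge0// ltW//.
  have -> : KF * (h * C) ^+ 2 = h * (h * (KF * C ^+ 2)) by ring.
  by rewrite ler_pM2l.
rewrite -(ler_pM2l h0) -[X in X * `|_| <= _](gtr0_norm h0) -normrM.
rewrite -[h * 'D_(W y0) F y0](addrK ('D_err F y0)).
rewrite (le_trans (ler_normB _ _))// [eps in leRHS]splitr mulrDr lerD//.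
exact: le_trans H H3.
Qed.

(** * Charts and tangent vectors *)

Section SmoothNear.
Context {R : realType}.
Implicit Types V W : normedModType R.

Lemma smooth_near_ext V W x (f g : V -> W) :
  (\forall y \near x, f y = g y) -> smooth_near x f -> smooth_near x g.
Proof.
move=> fg [U [oU Ux sf]]; exists (U `&` [set y | f y = g y]°); split.
- by apply: openI => //; exact: open_interior.
- by split.
move=> k; apply: (@Ck_ext _ _ _ _ _ f).
- by apply: openI => //; exact: open_interior.
- by move=> y [_ /interior_subset].
- by apply: Ck_sub (sf k) => y [].
Qed.

Lemma smooth_near_nbhs V W x (f : V -> W) :
  smooth_near x f -> \forall y \near x, smooth_near y f.
Proof.
move=> [U [oU Ux sf]].
have : nbhs x U by exact: open_nbhs_nbhs.
by apply: filterS => y Uy; exists U.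
Qed.

Lemma smooth_near_continuous V W x (f : V -> W) :
  smooth_near x f -> {for x, continuous f}.
Proof. by move=> [U [oU Ux /(_ 0)[+ _]]]; exact. Qed.

Lemma smooth_near_derive_continuous V W x v (f : V -> W) :
  smooth_near x f -> {for x, continuous (fun z => 'D_v f z)}.
Proof.
by move=> [U [oU Ux /(_ 1)[_ /(_ v)[_ [+ _]]]]]; exact.
Qed.

Lemma smooth_near_derivable V W x v (f : V -> W) :
  smooth_near x f -> derivable f x v.
Proof. by move=> [U [oU Ux /(_ 1)[_ /(_ v)[+ _]]]]; exact. Qed.

Lemma smooth_near_mul V x (f g : V -> R) :
  smooth_near x f -> smooth_near x g -> smooth_near x (fun y => f y * g y).
Proof.
move=> [U [oU Ux sf]] [U' [oU' Ux' sg]]; exists (U `&` U').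
split=> [|//|k]; first exact: openI.
apply: Ck_mul; first exact: openI.
- by apply: Ck_sub (sf k) => y [].
- by apply: Ck_sub (sg k) => y [].
Qed.

Lemma smooth_near_affine V V' W (L : V' -> V) (c : V) x (f : V -> W) :
  linear L -> continuous L ->
  smooth_near (L x + c) f -> smooth_near x (fun y => f (L y + c)).
Proof.
move=> lL cL [U [oU Ux sf]]; exists [set y | U (L y + c)]; split=> [|//|k].
  rewrite (_ : [set y | _] = (fun y => L y + c) @^-1` U)//.
  apply: open_comp => // y _; apply: cvgD; first exact: cL.
  exact: cvg_cst.
exact: Ck_affine.
Qed.

Lemma smooth_near_coord V m x (g : V -> 'rV[R]_m) j :
  smooth_near x g -> smooth_near x (fun y => g y 0 j).
Proof.
by move=> [U [oU Ux sg]]; exists U; split=> // k; exact: Ck_coord.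
Qed.

Lemma smooth_near_id V (x : V) : smooth_near x (id : V -> V).
Proof.
exists setT; split=> //; first exact: openT.
case=> [|k]; (split; first by move=> y _; exact: cvg_id) => // v.
split=> [y _|]; first exact: derivable_id.
apply: (@Ck_ext _ _ _ _ _ (cst v)); [exact: openT| |exact/Ck_cst/openT].
by move=> y _; rewrite derive_id.
Qed.

Lemma smooth_near_comp V m (g : V -> 'rV[R]_m) (f : 'rV[R]_m -> R) x :
  smooth_near (g x) f -> (forall j, smooth_near x (fun y => g y 0 j)) ->
  smooth_near x (f \o g).
Proof.
move=> [U' [oU' Ux' sf]] sg.
have [U HU] := choice sg.
have cg : {for x, continuous g}.
  by apply: continuous_rowP => j; exact: smooth_near_continuous.
have nU : \forall y \near x, forall j, U j y.
  by apply: nbhs_forall => j; have [oU Ux _] := HU j; exact: open_nbhs_nbhs.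
have nU' : \forall y \near x, U' (g y).
  by apply: cg; exact: open_nbhs_nbhs.
exists ([set y | (forall j, U j y) /\ U' (g y)]°); split.
- exact: open_interior.
- exact: filterI nU nU'.
move=> k; apply: Ck_comp oU' _ _ (sf k); first exact: open_interior.
- by move=> y /interior_subset[].
- move=> j; have [_ _ sgj] := HU j.
  by apply: Ck_sub (sgj k) => y /interior_subset[+ _]; exact.
Qed.

Lemma smooth_near_is_derive_comp V m (g : V -> 'rV[R]_m)
    (f : 'rV[R]_m -> R) x v :
  smooth_near (g x) f -> (forall j, derivable (fun y => g y 0 j) x v) ->
  'D_v (f \o g) x = 'D_(\row_j 'D_v (fun y => g y 0 j) x) f (g x).
Proof.
move=> [U [oU Ux sf]] dg.
have df := differentiable_C1 oU Ux (sf 1).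
by have [_ ->] := is_derive_comp_row df dg.
Qed.

Lemma smooth_near_deriveD V x v w (f : V -> R) : smooth_near x f ->
  'D_(v + w) f x = 'D_v f x + 'D_w f x.
Proof. by move=> [U [oU Ux sf]]; exact: deriveDr oU Ux (sf 1). Qed.

Lemma smooth_near_derive_row m x v (f : 'rV[R]_m -> R) : smooth_near x f ->
  'D_v f x = \sum_j v 0 j * 'D_(delta_mx 0 j) f x.
Proof. by move=> [U [oU Ux sf]]; exact: derive_rowE oU Ux (sf 1). Qed.

End SmoothNear.

Section Charts.
Context {R : realType} {X : topologicalType} {m : nat}.
Variable A : set (chart X 'rV[R]_m).
Hypothesis atlasA : is_atlas A.
Implicit Types (c d : chart X 'rV[R]_m) (p q : X) (S T : set X).
Implicit Types (phi psi F : X -> R) (v : functional R X).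

Lemma nbhs_cdom c p : A c -> cdom c p -> nbhs p (cdom c).
Proof.
move=> Ac cp; have [/(_ c Ac)[oc _ _ _ _] _ _] := atlasA.
exact: open_nbhs_nbhs.
Qed.

Lemma cfwdK c p : A c -> cdom c p -> cbwd c (cfwd c p) = p.
Proof.
by move=> Ac cp; have [/(_ c Ac)[_ _ + _ _] _ _] := atlasA; apply.
Qed.

Lemma cfwd_continuous c p : A c -> cdom c p -> {for p, continuous (cfwd c)}.
Proof.
by move=> Ac cp; have [/(_ c Ac)[_ _ _ + _] _ _] := atlasA; apply.
Qed.

Lemma cbwd_continuous c p : A c -> cdom c p ->
  {for cfwd c p, continuous (cbwd c)}.
Proof.
move=> Ac cp; have [/(_ c Ac)[_ _ _ _ +] _ _] := atlasA; apply.
by exists p.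
Qed.

(** [cbwd c] is meaningful only on the image of the chart; that image is open, so near [cfwd c p] it
    is a genuine inverse. *)
Lemma near_cbwd c p (P : set X) : A c -> cdom c p -> nbhs p P ->
  \forall y \near cfwd c p, [/\ cdom c (cbwd c y), P (cbwd c y) &
    cfwd c (cbwd c y) = y].
Proof.
move=> Ac cp nP.
have [/(_ c Ac)[_ oc _ _ _] _ _] := atlasA.
have n1 : nbhs (cfwd c p) (cfwd c @` cdom c).
  by apply: open_nbhs_nbhs; split=> //; exists p.
have n2 : nbhs (cfwd c p) (cbwd c @^-1` P).
  by apply: (cbwd_continuous Ac cp); rewrite /= cfwdK.
apply: filterS (filterI n1 n2) => y [[q cq <-]] /=.
by rewrite cfwdK.
Qed.

Lemma smooth_at_setTE p F : smooth_at A setT p F <->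
  (forall c, A c -> cdom c p -> smooth_near (cfwd c p) (F \o cbwd c)).
Proof.
split=> [[H [sH eH]] c Ac cp|sF]; last first.
  by exists F; split=> //; near=> q.
apply: smooth_near_ext (sH c Ac cp).
have nP : nbhs p [set q | F q = H q] by apply: filterS eH => q; apply.
by apply: filterS (near_cbwd Ac cp nP) => y [_ /= ->].
Unshelve. all: by end_near. Qed.

Lemma transition_smooth c d p : A c -> A d -> cdom c p -> cdom d p ->
  smooth_near (cfwd d p) (cfwd c \o cbwd d).
Proof.
move=> Ac Ad cp dp; have [_ _ tr] := atlasA.
have s := tr d c Ad Ac.
have nn : nbhs (cfwd d p) (cfwd d @` (cdom d `&` cdom c)).
  apply: filterS (near_cbwd Ad dp (nbhs_cdom Ac cp)) => y [h1 h2 h3].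
  by exists (cbwd d y).
exists (cfwd d @` (cdom d `&` cdom c))°; split.
- exact: open_interior.
- by [].
- by move=> k; apply: Ck_sub (s k); exact: interior_subset.
Qed.

(** Smoothness in one chart suffices, because the other charts differ from it by smooth transition
    maps. *)
Lemma smooth_at_chart c p (f : 'rV[R]_m -> R) : A c -> cdom c p ->
  smooth_near (cfwd c p) f -> smooth_at A setT p (f \o cfwd c).
Proof.
move=> Ac cp sf; apply/smooth_at_setTE => d Ad dp.
apply: (@smooth_near_comp _ _ _ (cfwd c \o cbwd d) f).
  by rewrite /= cfwdK.
by move=> j; apply: smooth_near_coord; exact: transition_smooth.
Qed.

Lemma smooth_at_ext S p phi psi :
  (\forall q \near p, S q -> phi q = psi q) ->
  smooth_at A S p phi -> smooth_at A S p psi.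
Proof.
move=> e [F [sF eF]]; exists F; split=> //.
by apply: filterS (filterI e eF) => q [e1 e2] Sq; rewrite -e1// e2.
Qed.

Lemma smooth_at_sub S T p phi : T `<=` S ->
  smooth_at A S p phi -> smooth_at A T p phi.
Proof.
move=> TS [F [sF eF]]; exists F; split=> //.
by apply: filterS eF => q e /TS; exact: e.
Qed.

Lemma smooth_at_extension S p phi : smooth_at A S p phi ->
  exists F, smooth_at A setT p F /\ \forall q \near p, S q -> phi q = F q.
Proof. by move=> [F [sF eF]]; exists F; split=> //; apply/smooth_at_setTE. Qed.

Lemma smooth_at_mul S p phi psi : smooth_at A S p phi -> smooth_at A S p psi ->
  smooth_at A S p (fun q => phi q * psi q).
Proof.
move=> [F [sF eF]] [H [sH eH]]; exists (fun q => F q * H q); split.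
  by move=> c Ac cp; apply: smooth_near_mul; [exact: sF|exact: sH].
by apply: filterS (filterI eF eH) => q [e1 e2] Sq; rewrite e1// e2.
Qed.

Definition ccoord c (j : 'I_m) (q : X) : R := cfwd c q 0 j.

Lemma smooth_at_ccoord c j p : A c -> cdom c p ->
  smooth_at A setT p (ccoord c j).
Proof.
move=> Ac cp; apply: (@smooth_at_chart c p (fun y => y 0 j)) => //.
exact/smooth_near_coord/smooth_near_id.
Qed.

Lemma smooth_at_continuous p F : smooth_at A setT p F ->
  {for p, continuous F}.
Proof.
move=> sF; have [_ /(_ p)[c Ac cp] _] := atlasA.
have sc := (smooth_at_setTE p F).1 sF c Ac cp.
have h : {for p, continuous ((F \o cbwd c) \o cfwd c)}.
  apply: continuous_comp; first exact: cfwd_continuous.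
  exact: smooth_near_continuous.
move: h; rewrite /prop_for /continuous_at /= cfwdK//; apply: cvg_trans.
apply: near_eq_cvg; apply: filterS (nbhs_cdom Ac cp) => q cq /=.
by rewrite cfwdK.
Qed.

Section Tangent.
Variables (S : set X) (p : X) (v : functional R X).
Hypothesis tv : tangent A S p v.

Lemma tangentD phi psi : smooth_at A S p phi -> smooth_at A S p psi ->
  v (fun q => phi q + psi q) = v phi + v psi.
Proof.
move=> s1 s2; have [_ _ lv _] := tv; have := lv 1 _ _ s1 s2.
rewrite mul1r => <-; congr (v _); apply/funext => q; by rewrite mul1r.
Qed.

Lemma tangent_cst (a : R) : v (cst a) = 0.
Proof.
have [_ _ lv mv] := tv.
have s1 (b : R) : smooth_at A S p (cst b) by exact: smooth_at_cst.
have v0 : v (cst 0) = 0.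
  have := lv (-1) _ _ (s1 0) (s1 0).
  rewrite mulN1r addNr => e; rewrite -[RHS]e; congr (v _); apply/funext => q.
  by rewrite /cst mulr0 addr0.
(* The Leibniz rule for 1 = 1 * 1 reads v(1) = v(1) + v(1). *)
have v1 : v (cst 1) = 0.
  have := mv _ _ (s1 1) (s1 1); rewrite /cst !mulr1 mul1r => e.
  by rewrite -[RHS](subrr (v (fun=> 1))) [X in X - _]e addrK.
have := lv a _ _ (s1 1) (s1 0); rewrite v1 v0 mulr0 addr0 => e; rewrite -[RHS]e.
by congr (v _); apply/funext => q; rewrite /cst mulr1 addr0.
Qed.

Lemma tangent_germ phi psi : smooth_at A S p phi ->
  (\forall q \near p, S q -> phi q = psi q) -> v phi = v psi.
Proof. by have [_ + _ _] := tv; apply. Qed.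

Lemma tangent_near_cst phi (a : R) :
  (\forall q \near p, S q -> phi q = a) -> v phi = 0.
Proof.
move=> e; rewrite -(tangent_cst a); symmetry; apply: tangent_germ.
  exact: smooth_at_cst.
by apply: filterS e => q e Sq; rewrite e.
Qed.

Lemma tangent_sum (I : Type) (r : seq I) (f : I -> X -> R) :
  (forall i, smooth_at A S p (f i)) ->
  smooth_at A S p (fun q => \sum_(i <- r) f i q) /\
  v (fun q => \sum_(i <- r) f i q) = \sum_(i <- r) v (f i).
Proof.
move=> sf; elim: r => [|i r [IH1 IH2]].
  rewrite big_nil (_ : (fun q => _) = cst 0); last first.
    by apply/funext => q; rewrite big_nil.
  by split; [exact: smooth_at_cst|exact: tangent_cst].
rewrite big_cons -IH2 (_ : (fun q => _) =
  (fun q => f i q + \sum_(j <- r) f j q)); last first.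
  by apply/funext => q; rewrite big_cons.
split; last exact: tangentD.
have := smooth_at_lin 1 (sf i) IH1; apply: smooth_at_ext.
by near=> q => _; rewrite mul1r.
Unshelve. all: by end_near. Qed.

Definition chart_components c : 'rV[R]_m := \row_j v (ccoord c j).

(* By Hadamard's lemma F = F(p) + sum_j (x_j - x_j(p)) g_j with smooth g_j, so
   that a derivation at p only sees the first derivatives of F. *)
Lemma tangentE c F : A c -> cdom c p -> smooth_at A setT p F ->
  v F = 'D_(chart_components c) (F \o cbwd c) (cfwd c p).
Proof.
move=> Ac cp sF; have sf := (smooth_at_setTE p F).1 sF c Ac cp.
have [_ _ lv mv] := tv.
have [g [sg gp fE]] := hadamard sf.
have sT phi : smooth_at A setT p phi -> smooth_at A S p phi.
  exact: smooth_at_sub.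
have sx j : smooth_at A S p (fun q => ccoord c j q - ccoord c j p).
  have := smooth_at_lin 1 (sT _ (smooth_at_ccoord j Ac cp))
    (smooth_at_cst A S p (- ccoord c j p)).
  by apply: smooth_at_ext; near=> q => _; rewrite mul1r.
have sgc j : smooth_at A S p (g j \o cfwd c) by apply/sT/smooth_at_chart.
have sxg j : smooth_at A S p
    (fun q => (ccoord c j q - ccoord c j p) * (g j \o cfwd c) q).
  exact: smooth_at_mul.
have [ss es] := tangent_sum (index_enum 'I_m) sxg.
have -> : v F = v (fun q => F p +
    \sum_j (ccoord c j q - ccoord c j p) * (g j \o cfwd c) q).
  apply: tangent_germ; first exact: sT.
  have n1 := cfwd_continuous Ac cp fE.
  apply: filterS (filterI (nbhs_cdom Ac cp) n1) => q [cq] /= + _.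
  by rewrite !cfwdK.
rewrite (tangentD (smooth_at_cst A S p (F p)) ss) tangent_cst add0r es.
rewrite (smooth_near_derive_row _ sf); apply: eq_bigr => j _.
rewrite mv// subrr mul0r addr0 /= gp mxE; congr (_ * _).
rewrite (tangentD (sT _ (smooth_at_ccoord j Ac cp)) (smooth_at_cst A S p _)).
by rewrite tangent_cst addr0.
Unshelve. all: by end_near. Qed.

End Tangent.

End Charts.

Lemma dmap_smoothE {R : realType} (X : Type) (Y : topologicalType)
    (W : normedModType R) (B : set (chart Y W)) (S : set Y) (q : Y)
    (f : X -> Y) (v : functional R X) (phi : Y -> R) :
  smooth_at B S q phi -> dmap B S q f v phi = v (phi \o f).
Proof. by rewrite /dmap; case: asboolP. Qed.

Lemma dmap_nonsmoothE {R : realType} (X : Type) (Y : topologicalType)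
    (W : normedModType R) (B : set (chart Y W)) (S : set Y) (q : Y)
    (f : X -> Y) (v : functional R X) (phi : Y -> R) :
  ~ smooth_at B S q phi -> dmap B S q f v phi = 0.
Proof. by rewrite /dmap; case: asboolP. Qed.

(** * Pushforward of derivations and descent to a subset *)

Section Pushforward.
Context {R : realType} {X Y : topologicalType} {m n : nat}.
Variables (A : set (chart X 'rV[R]_m)) (B : set (chart Y 'rV[R]_n)).
Hypothesis atlasA : is_atlas A.

Lemma dmap_tangent (S : set X) (p : X) (f : X -> Y) (v : functional R X) :
  tangent A S p v -> f @ within S (nbhs p) --> f p ->
  (forall phi, smooth_at B setT (f p) phi -> smooth_at A S p (phi \o f)) ->
  tangent B setT (f p) (dmap B setT (f p) f v).
Proof.
move=> tv cf sf; have [_ gv lv mv] := tv; split.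
- by move=> phi ns; rewrite dmap_nonsmoothE.
- move=> phi psi sphi e; have spsi := smooth_at_ext e sphi.
  rewrite !dmap_smoothE//; apply: gv; first exact: sf.
  have n1 : nbhs (f p) [set q | phi q = psi q] by apply: filterS e => q; exact.
  exact: cf n1.
- move=> a phi psi s1 s2; rewrite !dmap_smoothE//; last exact: smooth_at_lin.
  by rewrite -lv//; exact: sf.
- move=> phi psi s1 s2; rewrite !dmap_smoothE//; last exact: smooth_at_mul.
  by rewrite -[phi (f p)]/((phi \o f) p) -[psi (f p)]/((psi \o f) p) -mv//;
    exact: sf.
Qed.

(** A germ on T is evaluated by applying v to an ambient smooth extension. Two extensions differ by
    a function vanishing on T near p, which v kills, so the result does not depend on the choice. *)
Lemma tangent_restrict (S T : set X) (p : X) (v : functional R X) :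
  tangent A S p v -> T `<=` S -> T p ->
  (forall F, smooth_at A setT p F ->
    (\forall q \near p, T q -> F q = 0) -> v F = 0) ->
  exists w, tangent A T p w /\ dmap A S p id w = v.
Proof.
move=> tv TS Tp kv; have [v0 gv lv mv] := tv.
have toS F : smooth_at A setT p F -> smooth_at A S p F by exact: smooth_at_sub.
(* The value 0 off the smooth germs is the convention built into [tangent]. *)
pose w : functional R X := fun phi =>
  match pselect (smooth_at A T p phi) with
  | left h => v (sval (cid (smooth_at_extension atlasA h)))
  | right _ => 0
  end.
have wE phi F : smooth_at A setT p F ->
    (\forall q \near p, T q -> phi q = F q) -> w phi = v F.
  move=> sF eF; rewrite /w; case: pselect => [h|]; last first.
    case; apply: (@smooth_at_ext _ _ _ _ _ _ F); last exact: smooth_at_sub sF.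
    by apply: filterS eF => q e Tq; rewrite e.
  case: cid => H [sH eH] /=; apply/eqP; rewrite -subr_eq0; apply/eqP.
  have := lv (-1) F H (toS _ sF) (toS _ sH); rewrite mulN1r addrC => <-.
  apply: kv; first exact: smooth_at_lin.
  apply: filterS (filterI eF eH) => q [e1 e2] Tq.
  by rewrite -e1// -e2// mulN1r addNr.
exists w; split.
- split.
  + by move=> phi ns; rewrite /w; case: pselect.
  + move=> phi psi sphi e.
    have [F [sF eF]] := smooth_at_extension atlasA sphi.
    rewrite (wE phi F)// (wE psi F)//.
    by apply: filterS (filterI e eF) => q [e1 e2] Tq; rewrite -e1// e2.
  + move=> a phi psi s1 s2.
    have [F [sF eF]] := smooth_at_extension atlasA s1.
    have [H [sH eH]] := smooth_at_extension atlasA s2.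
    rewrite (wE phi F)// (wE psi H)// -lv; [|exact: toS|exact: toS].
    apply: wE; first exact: smooth_at_lin.
    by apply: filterS (filterI eF eH) => q [e1 e2] Tq; rewrite e1// e2.
  + move=> phi psi s1 s2.
    have [F [sF eF]] := smooth_at_extension atlasA s1.
    have [H [sH eH]] := smooth_at_extension atlasA s2.
    rewrite (wE phi F)// (wE psi H)//.
    rewrite (nbhs_singleton eF)// (nbhs_singleton eH)//.
    rewrite -mv; [|exact: toS|exact: toS].
    apply: wE; first exact: smooth_at_mul.
    by apply: filterS (filterI eF eH) => q [e1 e2] Tq; rewrite e1// e2.
- apply/funext => phi; have [sphi|ns] := pselect (smooth_at A S p phi).
    rewrite dmap_smoothE//.
    have [F [sF eF]] := smooth_at_extension atlasA sphi.
    rewrite [RHS](gv _ F)//; apply: wE => //.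
    by apply: filterS eF => q e /TS; exact: e.
  by rewrite dmap_nonsmoothE// v0.
Qed.

End Pushforward.

(** * Slices and the product rule on a product of charts *)

Section Products.
Context {R : realType}.

Lemma near_pairl (T U : topologicalType) (x : T) (y : U) (P : set (T * U)) :
  nbhs (x, y) P -> \forall x' \near x, P (x', y).
Proof.
move=> [[Q1 Q2] /= [n1 n2] QP]; apply: filterS n1 => x' Qx'.
by apply: QP; split=> //=; exact: nbhs_singleton.
Qed.

Lemma near_pairr (T U : topologicalType) (x : T) (y : U) (P : set (T * U)) :
  nbhs (x, y) P -> \forall y' \near y, P (x, y').
Proof.
move=> [[Q1 Q2] /= [n1 n2] QP]; apply: filterS n2 => y' Qy'.
by apply: QP; split=> //=; exact: nbhs_singleton.
Qed.

Lemma continuous_pair (T U U' : topologicalType) (f : T -> U) (g : T -> U')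
    (x : T) : {for x, continuous f} -> {for x, continuous g} ->
  {for x, continuous (fun y => (f y, g y))}.
Proof. by move=> cf cg; exact: cvg_pair. Qed.

Implicit Types (V W : normedModType R).

Lemma linear_pairl V W : linear (fun y : V => (y, 0 : W)).
Proof. by move=> a y z; congr pair; rewrite /= scaler0 addr0. Qed.

Lemma linear_pairr V W : linear (fun y : W => (0 : V, y)).
Proof. by move=> a y z; congr pair; rewrite /= scaler0 addr0. Qed.

Lemma continuous_pairl V W : continuous (fun y : V => (y, 0 : W)).
Proof. by move=> y; apply: cvg_pair; [exact: cvg_id|exact: cvg_cst]. Qed.

Lemma continuous_pairr V W : continuous (fun y : W => (0 : V, y)).
Proof. by move=> y; apply: cvg_pair; [exact: cvg_cst|exact: cvg_id]. Qed.

Lemma smooth_near_slicel V W (f : V * W -> R) a b : smooth_near (a, b) f ->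
  smooth_near a (fun y => f (y, b)) /\
  forall v, 'D_v (fun y => f (y, b)) a = 'D_(v, 0) f (a, b).
Proof.
have e y : (y, 0) + (0, b) = (y, b) :> V * W.
  by congr pair; rewrite /= ?addr0 ?add0r.
move=> sf.
have E : (fun y => f (y, b)) = (fun y => f ((y, 0) + (0, b))).
  by apply/funext => y; rewrite e.
split=> [|v]; rewrite E.
  apply: (@smooth_near_affine _ _ _ _ (fun y => (y, 0)) (0, b)).
  - exact: linear_pairl.
  - exact: continuous_pairl.
  - by rewrite e.
by have [_ ->] := derive_affine (0, b) f a v (@linear_pairl V W); rewrite e.
Qed.

Lemma smooth_near_slicer V W (f : V * W -> R) a b : smooth_near (a, b) f ->
  smooth_near b (fun y => f (a, y)) /\
  forall v, 'D_v (fun y => f (a, y)) b = 'D_(0, v) f (a, b).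
Proof.
have e y : (0, y) + (a, 0) = (a, y) :> V * W.
  by congr pair; rewrite /= ?addr0 ?add0r.
move=> sf.
have E : (fun y => f (a, y)) = (fun y => f ((0, y) + (a, 0))).
  by apply/funext => y; rewrite e.
split=> [|v]; rewrite E.
  apply: (@smooth_near_affine _ _ _ _ (fun y => (0, y)) (a, 0)).
  - exact: linear_pairr.
  - exact: continuous_pairr.
  - by rewrite e.
by have [_ ->] := derive_affine (a, 0) f b v (@linear_pairr V W); rewrite e.
Qed.

Lemma smooth_map_continuous (X Y : topologicalType) V W
    (A : set (chart X V)) (B : set (chart Y W)) (f : X -> Y) :
  smooth_map A setT B f -> continuous f.
Proof.
move=> sf p P nP; have [c _] := sf p I.
suff : nbhs p (f @^-1` P) by [].
have h : nbhs p [set q | [set: X] q -> P (f q)] := c P nP.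
by apply: filterS h => q /=; exact.
Qed.

Lemma smooth_map_comp (X Y : topologicalType) V W
    (A : set (chart X V)) (B : set (chart Y W)) (f : X -> Y) p phi :
  smooth_map A setT B f -> smooth_at B setT (f p) phi ->
  smooth_at A setT p (phi \o f).
Proof. by move=> sf; have [_] := sf p I; apply. Qed.

End Products.

Section ProductRule.
Context {R : realType} {m : nat}.

(** The chain rule above is stated for functions of a row vector, whereas product charts take values
    in a product; this linear identification passes from one to the other. *)
Let unrow (z : 'rV[R]_(m + m)) : 'rV[R]_m * 'rV[R]_m := (lsubmx z, rsubmx z).

Let unrow_linear : linear unrow.
Proof. by move=> a y z; congr pair; rewrite /= linearP. Qed.

Let unrow_continuous : continuous unrow.
Proof.
move=> z; apply: continuous_pair; apply: continuous_rowP => j.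
  rewrite (_ : (fun y => _) = fun y : 'rV[R]_(m + m) => y 0 (lshift m j)).
    exact: coord_continuous.
  by apply/funext => y; rewrite mxE.
rewrite (_ : (fun y => _) = fun y : 'rV[R]_(m + m) => y 0 (rshift m j)).
  exact: coord_continuous.
by apply/funext => y; rewrite mxE.
Qed.

(** The velocity of y |-> (y, g y) is the sum of a vector in the first factor and one in the second,
    and each partial derivative is that of a slice. In the application g is inversion and f an
    extension of the product. *)
Lemma derive_pair_comp (f : 'rV[R]_m * 'rV[R]_m -> R)
    (g : 'rV[R]_m -> 'rV[R]_m) a w : smooth_near (a, g a) f ->
  (forall j, smooth_near a (fun y => g y 0 j)) ->
  smooth_near a (fun y => f (y, g y)) /\
  'D_w (fun y => f (y, g y)) a =
    'D_w (fun y => f (y, g a)) a + 'D_w (fun y => f (a, g y)) a.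
Proof.
move=> sf sg.
pose h y := row_mx y (g y).
(* The translation by 0 gives [f2] the affine form expected by [smooth_near_affine]. *)
pose f2 (z : 'rV[R]_(m + m)) := f (unrow z + 0).
have hK y : unrow (h y) + 0 = (y, g y).
  by rewrite addr0 /unrow row_mxKl row_mxKr.
have sf2 : smooth_near (h a) f2.
  apply: (@smooth_near_affine _ _ _ _ unrow 0) => //; first by rewrite hK.
have sh j : smooth_near a (fun y => h y 0 j).
  case: (split_ordP j) => i ->.
    rewrite (_ : (fun y => _) = fun y : 'rV[R]_m => y 0 i).
      exact/smooth_near_coord/smooth_near_id.
    by apply/funext => y; rewrite /h row_mxEl.
  rewrite (_ : (fun y => _) = fun y : 'rV[R]_m => g y 0 i); first exact: sg.
  by apply/funext => y; rewrite /h row_mxEr.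
have E : (fun y => f (y, g y)) = f2 \o h.
  by apply/funext => y; rewrite /f2 /= hK.
split; first by rewrite E; exact: smooth_near_comp.
rewrite E (smooth_near_is_derive_comp sf2); last first.
  by move=> j; exact: smooth_near_derivable.
set w2 := \row_j 'D_w (fun y => g y 0 j) a.
have -> : \row_j 'D_w (fun y => h y 0 j) a = row_mx w 0 + row_mx 0 w2.
  apply/rowP => j; rewrite mxE add_row_mx addr0 add0r.
  case: (split_ordP j) => i ->.
    rewrite row_mxEl (_ : (fun y => _) = fun y : 'rV[R]_m => y 0 i).
      have dI : derivable (id : 'rV[R]_m -> 'rV[R]_m) a w by exact: derivable_id.
      have /(congr1 (fun z : 'rV[R]_m => z 0 i)) := derive_mx dI.
      by rewrite derive_id mxE => ->.
    by apply/funext => y; rewrite /h row_mxEl.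
  rewrite row_mxEr mxE (_ : (fun y => _) = fun y : 'rV[R]_m => g y 0 i)//.
  by apply/funext => y; rewrite /h row_mxEr.
rewrite (smooth_near_deriveD _ _ sf2).
have D2 z : 'D_z f2 (h a) = 'D_(unrow z) f (a, g a).
  by rewrite (derive_affine 0 f (h a) z unrow_linear).2 hK.
rewrite !D2 /unrow !row_mxKl !row_mxKr.
have [_ ->] := smooth_near_slicel sf.
have [s2 e2] := smooth_near_slicer sf.
congr (_ + _); rewrite -e2 [RHS](smooth_near_is_derive_comp s2)//.
by move=> j; exact: smooth_near_derivable.
Qed.

End ProductRule.

(** * Lie groupoids *)

Section Groupoid.
Context {R : realType} {n k : nat} (G : lie_groupoid R n k).

Local Notation M := (base G).
Local Notation Ar := (arrow G).
Local Notation AM := (atlas (base G)).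
Local Notation AG := (atlas (arrow G)).
Local Notation s := (@src R n k G).
Local Notation t := (@tgt R n k G).
Local Notation u := (@unit_ R n k G).
Local Notation inv := (@inv_ R n k G).
Local Notation mul := (@mul_ R n k G).

Let aG : is_atlas AG := atlasP (arrow G).
Let aM : is_atlas AM := atlasP (base G).

Lemma src_continuous : continuous s.
Proof. exact: smooth_map_continuous (@src_smooth _ _ _ G). Qed.

Lemma tgt_continuous : continuous t.
Proof. exact: smooth_map_continuous (@tgt_smooth _ _ _ G). Qed.

Lemma unit_continuous : continuous u.
Proof. exact: smooth_map_continuous (@unit_smooth _ _ _ G). Qed.

Lemma inv_continuous : continuous inv.
Proof. exact: smooth_map_continuous (@inv_smooth _ _ _ G). Qed.

Lemma mul_near h g (P : set Ar) : s h = t g -> nbhs (mul h g) P ->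
  \forall z \near (h, g), s z.1 = t z.2 -> P (mul z.1 z.2).
Proof.
move=> hg nP; have [c _] := @mul_smooth _ _ _ G (h, g) hg.
exact: c P nP.
Qed.

Lemma mulr_near h g (P : set Ar) : s h = t g -> nbhs (mul h g) P ->
  \forall h' \near h, sfiber (t g) h' -> P (mul h' g).
Proof. by move=> hg nP; exact: near_pairl (mul_near hg nP). Qed.

Lemma mull_near g h (P : set Ar) : s g = t h -> nbhs (mul g h) P ->
  \forall h' \near h, tfiber (s g) h' -> P (mul g h').
Proof.
move=> gh nP; apply: filterS (near_pairr (mul_near gh nP)) => h' /= H e.
exact: H (esym e).
Qed.

(** All later differentiation of products takes place on [Phi], which is smooth on a full
    neighbourhood in any pair of charts. *)
Lemma mul_extension h g psi : s h = t g -> smooth_at AG setT (mul h g) psi ->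
  exists Phi : Ar * Ar -> R, (forall c d, AG c -> AG d -> cdom c h -> cdom d g ->
    smooth_near (cfwd c h, cfwd d g)
      (fun w : 'rV[R]_k * 'rV[R]_k => Phi (cbwd c w.1, cbwd d w.2))) /\
  \forall z \near (h, g), s z.1 = t z.2 -> psi (mul z.1 z.2) = Phi z.
Proof.
move=> hg spsi; have [_ /(_ psi spsi)[Phi [sPhi ePhi]]] :=
  @mul_smooth _ _ _ G (h, g) hg.
exists Phi; split=> // c d Ac Ad ch dg.
apply: (sPhi (Chart (cdom c `*` cdom d)
              (fun z => (cfwd c z.1, cfwd d z.2))
              (fun w => (cbwd c w.1, cbwd d w.2)))) => //.
by exists c, d.
Qed.

Lemma smooth_at_slicel (Phi : Ar * Ar -> R) c d h g : AG c -> AG d ->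
  cdom c h -> cdom d g -> smooth_near (cfwd c h, cfwd d g)
      (fun w : 'rV[R]_k * 'rV[R]_k => Phi (cbwd c w.1, cbwd d w.2)) ->
  smooth_at AG setT h (fun h' => Phi (h', g)).
Proof.
move=> Ac Ad ch dg /smooth_near_slicel[+ _] /=.
rewrite /= (cfwdK aG Ad dg) => /(smooth_at_chart aG Ac ch); apply: smooth_at_ext.
by apply: filterS (nbhs_cdom aG Ac ch) => q cq _ /=; rewrite (cfwdK aG Ac cq).
Qed.

Lemma smooth_at_slicer (Phi : Ar * Ar -> R) c d h g : AG c -> AG d ->
  cdom c h -> cdom d g -> smooth_near (cfwd c h, cfwd d g)
      (fun w : 'rV[R]_k * 'rV[R]_k => Phi (cbwd c w.1, cbwd d w.2)) ->
  smooth_at AG setT g (fun g' => Phi (h, g')).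
Proof.
move=> Ac Ad ch dg /smooth_near_slicer[+ _] /=.
rewrite /= (cfwdK aG Ac ch) => /(smooth_at_chart aG Ad dg); apply: smooth_at_ext.
by apply: filterS (nbhs_cdom aG Ad dg) => q dq _ /=; rewrite (cfwdK aG Ad dq).
Qed.

Lemma smooth_at_mulr h g psi : s h = t g -> smooth_at AG setT (mul h g) psi ->
  smooth_at AG (sfiber (t g)) h (fun h' => psi (mul h' g)).
Proof.
move=> hg /(mul_extension hg)[Phi [sPhi ePhi]].
have [_ /(_ h)[c Ac ch] _] := aG; have [_ /(_ g)[d Ad dg] _] := aG.
apply: (@smooth_at_ext _ _ _ _ _ _ (fun h' => Phi (h', g))).
  by apply: filterS (near_pairl ePhi) => h' e /e.
apply: (@smooth_at_sub _ _ _ _ setT) => //.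
exact: smooth_at_slicel (sPhi c d Ac Ad ch dg).
Qed.

Lemma smooth_at_mull g h psi : s g = t h -> smooth_at AG setT (mul g h) psi ->
  smooth_at AG (tfiber (s g)) h (fun h' => psi (mul g h')).
Proof.
move=> gh /(mul_extension gh)[Phi [sPhi ePhi]].
have [_ /(_ g)[c Ac cg] _] := aG; have [_ /(_ h)[d Ad dh] _] := aG.
apply: (@smooth_at_ext _ _ _ _ _ _ (fun h' => Phi (g, h'))).
  by apply: filterS (near_pairr ePhi) => h' e /esym/e.
apply: (@smooth_at_sub _ _ _ _ setT) => //.
exact: smooth_at_slicer (sPhi c d Ac Ad cg dh).
Qed.

Lemma smooth_at_inv (S T : set Ar) h psi : (forall q, S q -> T (inv q)) ->
  smooth_at AG T (inv h) psi -> smooth_at AG S h (psi \o inv).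
Proof.
move=> ST /(smooth_at_extension aG)[F [sF eF]].
apply: (@smooth_at_ext _ _ _ _ _ _ (F \o inv)).
  have eF' : \forall q \near h, T (inv q) -> psi (inv q) = F (inv q).
    exact: inv_continuous eF.
  by apply: filterS eF' => q e /ST/e.
apply: (@smooth_at_sub _ _ _ _ setT) => //.
exact: smooth_map_comp (@inv_smooth _ _ _ G) sF.
Qed.

Lemma inv_unit x : inv (u x) = u x.
Proof.
have := @mul_invl _ _ _ G (u x); rewrite src_unit => e.
by have := @mul_unitr _ _ _ G (inv (u x)); rewrite src_inv tgt_unit e => <-.
Qed.

Lemma mul_unit_unit x : mul (u x) (u x) = u x.
Proof. by have := @mul_unitl _ _ _ G (u x); rewrite tgt_unit. Qed.

Lemma mulKV h g : s h = t g -> mul (mul h g) (inv g) = h.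
Proof. by move=> e; rewrite -Defs.mulA ?tgt_inv// mul_invr -e mul_unitr. Qed.

Lemma mulVK h g : s h = s g -> mul (mul h (inv g)) g = h.
Proof.
by move=> e; rewrite -Defs.mulA ?tgt_inv ?src_inv// mul_invl -e mul_unitr.
Qed.

(** Each nested [dmap] tests smoothness before it evaluates; phi and its left translate at the unit
    pass these tests, so no default value 0 intervenes. *)
Lemma deltaE_smooth (alpha : sections G) g phi : smooth_at AG setT g phi ->
  delta alpha g phi = alpha (t g) (fun h => phi (mul h g)) +
                      alpha (s g) (fun h => phi (mul g (inv h))).
Proof.
move=> sphi; rewrite deltaE.
have sub S : smooth_at AG S g phi by exact: smooth_at_sub sphi.
have e1 : to_TG g (rtrans g (alpha (t g))) phi =
    alpha (t g) (fun h => phi (mul h g)).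
  by rewrite /to_TG /rtrans !dmap_smoothE.
have gu : mul g (u (s g)) = g by rewrite mul_unitr.
have s2 : smooth_at AG (tfiber (s g)) (u (s g)) (phi \o mul g).
  by apply: smooth_at_mull; rewrite ?tgt_unit// gu.
have e2 : to_TG g (ltrans g (d_inv (s g) (alpha (s g)))) phi =
    alpha (s g) (fun h => phi (mul g (inv h))).
  by rewrite /to_TG /ltrans /d_inv !dmap_smoothE.
by rewrite -e1 -e2.
Qed.

Lemma delta_nonsmooth (alpha : sections G) g phi :
  ~ smooth_at AG setT g phi -> delta alpha g phi = 0.
Proof.
move=> ns; rewrite deltaE.
by rewrite -[LHS]/(_ phi + _ phi) /to_TG !dmap_nonsmoothE// addr0.
Qed.

(** * The right-invariant vector field of a section, and tangency to the isotropy groups *)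

Section RightInvariant.
Variable alpha : sections G.
Hypothesis alpha_section : algebroid_section alpha.

(** The value is taken in the tangent space of the whole arrow space, not of the source fibre: its
    components in an ambient chart drive the Euler polygons. *)
Definition right_field (q : Ar) : functional R Ar :=
  dmap AG setT q (mul^~ q) (alpha (t q)).

Lemma right_fieldE q phi : smooth_at AG setT q phi ->
  right_field q phi = alpha (t q) (fun h => phi (mul h q)).
Proof. by move=> sphi; rewrite /right_field dmap_smoothE. Qed.

Lemma right_field_tangent q : tangent AG setT q (right_field q).
Proof.
have [/(_ (t q)) ta _] := alpha_section.
have uq : mul (u (t q)) q = q by exact: mul_unitl.
have su : s (u (t q)) = t q by exact: src_unit.
have := @dmap_tangent _ _ _ _ _ AG AG _ _ (mul^~ q) _ ta.
rewrite uq; apply.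
- by move=> P nP; have := mulr_near su; rewrite uq; apply.
- by move=> phi sphi; apply: smooth_at_mulr => //; rewrite uq.
Qed.

(* On the composable pairs near (1, g) the function psi(hq) extends to a smooth
   Phi(h, q), and alpha sees only the first derivatives of Phi in h. *)
Lemma right_field_continuous g psi : smooth_at AG setT g psi ->
  {for g, continuous (fun q => alpha (t q) (fun h => psi (mul h q)))}.
Proof.
move=> spsi; have [ta sa] := alpha_section.
have ug : mul (u (t g)) g = g by exact: mul_unitl.
have su : s (u (t g)) = t g by exact: src_unit.
have [|Phi [sPhi ePhi]] := mul_extension su (psi := psi); first by rewrite ug.
have [_ /(_ (u (t g)))[c Ac cu] _] := aG; have [_ /(_ g)[d Ad dg] _] := aG.
have {}sPhi := sPhi c d Ac Ad cu dg.
pose Phi' (w : 'rV[R]_k * 'rV[R]_k) := Phi (cbwd c w.1, cbwd d w.2).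
pose z q := (cfwd c (u (t q)), cfwd d q).
have cut : {for g, continuous (u \o t)}.
  by apply: continuous_comp; [exact: tgt_continuous|exact: unit_continuous].
have cz : {for g, continuous z}.
  apply: continuous_pair; last exact: (cfwd_continuous aG Ad dg).
  apply: (@continuous_comp _ _ _ (u \o t) (cfwd c)) => //.
  exact: (cfwd_continuous aG Ac cu).
(* In this form the dependence on q is through the components of alpha, smooth on the base because
   alpha is a smooth section, and through the first derivatives of [Phi'] at [z q]. *)
have ez : \forall q \near g, alpha (t q) (fun h => psi (mul h q)) =
    \sum_j alpha (t q) (ccoord c j) * 'D_(delta_mx 0 j, 0) Phi' (z q).
  have n1 : \forall q \near g, smooth_near (z q) Phi'.
    exact: cz (smooth_near_nbhs sPhi).
  have n2 : \forall q \near g, \forall h \near u (t q), s h = t q ->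
      psi (mul h q) = Phi (h, q).
    have cp : {for g, continuous (fun q => (u (t q), q))}.
      by apply: continuous_pair => //; exact: cvg_id.
    pose P := [set z : Ar * Ar | s z.1 = t z.2 -> psi (mul z.1 z.2) = Phi z].
    have iP : \forall q \near g, nbhs (u (t q), q) P.
      exact: cp _ (nbhs_interior ePhi).
    by apply: filterS iP => q; exact: near_pairl.
  have n3 : \forall q \near g, cdom c (u (t q)).
    exact: cut (nbhs_cdom aG Ac cu).
  apply: filterS (filterI (filterI n1 n2) (filterI n3 (nbhs_cdom aG Ad dg))).
  move=> q [[sq eq] [cq dq]].
  have sl := smooth_at_slicel Ac Ad cq dq sq.
  have -> : alpha (t q) (fun h => psi (mul h q)) =
            alpha (t q) (fun h => Phi (h, q)).
    symmetry; apply: (tangent_germ (ta (t q))).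
      exact: smooth_at_sub sl.
    by apply: filterS eq => h e /e.
  rewrite (tangentE aG (ta (t q)) Ac cq sl).
  have [s1 s2] := smooth_near_slicel sq.
  have sE : (fun h => Phi (h, q)) \o cbwd c = (fun y => Phi' (y, cfwd d q)).
    by apply/funext => y; rewrite /Phi' /= (cfwdK aG Ad dq).
  rewrite sE (smooth_near_derive_row _ s1); apply: eq_bigr => j _.
  by rewrite s2 mxE.
move=> P; rewrite (nbhs_singleton ez) => nP.
have cS : {for g, continuous (fun q =>
    \sum_j alpha (t q) (ccoord c j) * 'D_(delta_mx 0 j, 0) Phi' (z q))}.
  apply: continuous_sumr => j; apply: continuousM.
    apply: (@continuous_comp _ _ _ t (fun y => alpha y (ccoord c j))).
      exact: tgt_continuous.
    apply: (smooth_at_continuous aM); apply: sa.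
    exact: smooth_at_ccoord.
  apply: (@continuous_comp _ _ _ z (fun w => 'D_(delta_mx 0 j, 0) Phi' w)) => //.
  exact: smooth_near_derive_continuous.
have := cS P nP; apply: filterS2 ez => q e; rewrite /= e; exact.
Qed.

Hypothesis anchor0 : forall x, anchor x (alpha x) = 0.

Lemma right_field_unit x F : smooth_at AG setT (u x) F ->
  right_field (u x) F = alpha x F.
Proof.
have [/(_ x) ta _] := alpha_section.
move=> sF; rewrite right_fieldE// tgt_unit; symmetry.
apply: (tangent_germ ta); first exact: smooth_at_sub sF.
by near=> h => <-; rewrite mul_unitr.
Unshelve. all: by end_near. Qed.

(** Since t(hq) = t(h), the left-hand side is the anchor of alpha applied to phi at t(q). *)
Lemma right_field_tgt q phi : smooth_at AM setT (t q) phi ->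
  right_field q (phi \o t) = 0.
Proof.
have [/(_ (t q)) ta _] := alpha_section => sphi.
rewrite right_fieldE; last exact: smooth_map_comp (@tgt_smooth _ _ _ G) sphi.
have := congr1 (@^~ phi) (anchor0 (t q)); rewrite /= /anchor dmap_smoothE//.
rewrite -[RHS in _ -> _ = RHS]/((0 : functional R M) phi) => <-; symmetry.
apply: (tangent_germ ta).
  apply: (@smooth_at_sub _ _ _ _ setT) => //.
  by apply: smooth_map_comp (@tgt_smooth _ _ _ G) _; rewrite tgt_unit.
by near=> h => /= sh; rewrite tgt_mul.
Unshelve. all: by end_near. Qed.

(** Since s(hq) = s(q), alpha is applied to a constant. *)
Lemma right_field_src q phi : smooth_at AM setT (s q) phi ->
  right_field q (phi \o s) = 0.
Proof.
have [/(_ (t q)) ta _] := alpha_section => sphi.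
rewrite right_fieldE; last exact: smooth_map_comp (@src_smooth _ _ _ G) sphi.
apply: (tangent_near_cst ta (a := phi (s q))).
by near=> h => /= sh; rewrite src_mul.
Unshelve. all: by end_near. Qed.

(** [derive_zero_of_level_sets] in a chart at 1_x, for the right-invariant field: F is constant on
    the level set of (s, t) through 1_x, so its derivative along the field at 1_x, which is
    alpha(x)(F), vanishes. *)
Lemma isotropy_kernel x F : smooth_at AG setT (u x) F ->
  (\forall q \near u x, isotropy x q -> F q = 0) -> alpha x F = 0.
Proof.
move=> sF F0.
have [_ /(_ (u x))[c Ac cu] _] := aG; have [_ /(_ x)[b Ab bx] _] := aM.
set y0 := cfwd c (u x).
have y0K : cbwd c y0 = u x by exact: (cfwdK aG Ac cu).
pose W y := chart_components (right_field (cbwd c y)) c.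
(* The coordinates of t and of s in a chart at x. The chart being injective, their common level set
   through 1_x is G_x near 1_x. *)
pose f (i : 'I_n + 'I_n) : Ar -> R :=
  match i with inl j => ccoord b j \o t | inr j => ccoord b j \o s end.
have sf q i : cdom b (t q) -> cdom b (s q) -> smooth_at AG setT q (f i).
  move=> bt bs; case: i => j /=.
    by apply: smooth_map_comp (@tgt_smooth _ _ _ G) _; exact: smooth_at_ccoord.
  by apply: smooth_map_comp (@src_smooth _ _ _ G) _; exact: smooth_at_ccoord.
have f0 q i : cdom b (t q) -> cdom b (s q) -> right_field q (f i) = 0.
  move=> bt bs; case: i => j /=.
    by apply: right_field_tgt; exact: smooth_at_ccoord.
  by apply: right_field_src; exact: smooth_at_ccoord.
have nP : \forall q \near u x, [/\ cdom b (t q), cdom b (s q) &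
    isotropy x q -> F q = 0].
  have n1 : \forall q \near u x, cdom b (t q).
    have h : nbhs (t (u x)) (cdom b).
      by rewrite tgt_unit; exact: (nbhs_cdom aM Ab bx).
    exact: (tgt_continuous h).
  have n2 : \forall q \near u x, cdom b (s q).
    have h : nbhs (s (u x)) (cdom b).
      by rewrite src_unit; exact: (nbhs_cdom aM Ab bx).
    exact: (src_continuous h).
  by apply: filterS (filterI n1 (filterI n2 F0)) => q [? [? ?]].
have ny := near_cbwd aG Ac cu nP.
have tq : cdom b (t (u x)) by rewrite tgt_unit.
have sq : cdom b (s (u x)) by rewrite src_unit.
have Fx : F (u x) = 0.
  by apply: (nbhs_singleton F0); rewrite /isotropy /= src_unit tgt_unit.
rewrite -right_field_unit//.
rewrite (tangentE aG (right_field_tangent _) Ac cu sF) -/y0.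
have -> : chart_components (right_field (u x)) c = W y0 by rewrite /W y0K.
apply: (@derive_zero_of_level_sets _ _ _ W (fun i => f i \o cbwd c)).
- apply: continuous_rowP => j.
  have cj : {for y0, continuous ((fun q =>
      alpha (t q) (fun h => ccoord c j (mul h q))) \o cbwd c)}.
    apply: continuous_comp; first exact: (cbwd_continuous aG Ac cu).
    rewrite y0K; apply: right_field_continuous => //.
    exact: smooth_at_ccoord.
  have e : \forall y \near y0, W y 0 j =
      alpha (t (cbwd c y)) (fun h => ccoord c j (mul h (cbwd c y))).
    apply: filterS ny => y [cy _ _]; rewrite mxE right_fieldE//.
    exact: smooth_at_ccoord.
  move=> P; rewrite (nbhs_singleton e) => nPP.
  have := cj P nPP; apply: filterS2 e => y ey; rewrite /= ey; exact.
- by move=> i; exact: ((smooth_at_setTE aG _ _).1 (sf (u x) i tq sq) c Ac cu).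
- exact: ((smooth_at_setTE aG _ _).1 sF c Ac cu).
- apply: filterS ny => y [cy [bt bs _] cK] i.
  have := tangentE aG (right_field_tangent (cbwd c y)) Ac cy (sf _ i bt bs).
  by rewrite f0// cK.
- apply: filterS ny => y [cy [bt bs Fy] cK] fy.
  rewrite /= y0K Fx; apply: Fy; split.
  + rewrite -(cfwdK aM Ab bs) -[RHS](cfwdK aM Ab bx); congr (cbwd b _).
    by apply/rowP => j; have := fy (inr j); rewrite /= y0K src_unit.
  + rewrite -(cfwdK aM Ab bt) -[RHS](cfwdK aM Ab bx); congr (cbwd b _).
    by apply/rowP => j; have := fy (inl j); rewrite /= y0K tgt_unit.
Qed.

Lemma isotropy_lift x : exists v, isotropy_algebra x v /\
  isotropy_incl x v = alpha x.
Proof.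
have [/(_ x) ta _] := alpha_section.
apply: (tangent_restrict aG ta).
- by move=> q [].
- by split; [exact: src_unit|exact: tgt_unit].
- exact: isotropy_kernel.
Qed.

End RightInvariant.

(** The product rule for h h^-1 = 1_x: the function theta(h h^-1) is constant on G_x, and its
    derivative along v is the sum of those of theta(h) and theta(h^-1). *)
Lemma isotropy_tangent_inv x (v : functional R Ar) theta :
  isotropy_algebra x v -> smooth_at AG (isotropy x) (u x) theta ->
  v (theta \o inv) = - v theta.
Proof.
move=> tv /[dup] sth /(smooth_at_extension aG)[F [sF eF]].
have su : s (u x) = t (u x) by rewrite src_unit tgt_unit.
have [|Phi [sPhi ePhi]] := mul_extension su (psi := F).
  by rewrite mul_unit_unit.
have [_ /(_ (u x))[c Ac cu] _] := aG.
have {}sPhi := sPhi c c Ac Ac cu cu.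
set y0 := cfwd c (u x) in sPhi.
pose P (z : Ar * Ar) := s z.1 = t z.2 -> F (mul z.1 z.2) = Phi z.
pose f (w : 'rV[R]_k * 'rV[R]_k) := Phi (cbwd c w.1, cbwd c w.2).
pose g y := cfwd c (inv (cbwd c y)).
have y0K : cbwd c y0 = u x by exact: (cfwdK aG Ac cu).
have gy0 : g y0 = y0 by rewrite /g y0K inv_unit.
have ninv (Q : set Ar) : nbhs (u x) Q -> \forall h \near u x, Q (inv h).
  by rewrite -{1}inv_unit => nQ; exact: (inv_continuous nQ).
have ci := ninv _ (nbhs_cdom aG Ac cu).
have sg j : smooth_near y0 (fun y => g y 0 j).
  have sj : smooth_at AG setT (u x) (ccoord c j \o inv).
    apply: smooth_map_comp (@inv_smooth _ _ _ G) _; rewrite inv_unit.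
    exact: smooth_at_ccoord.
  exact: ((smooth_at_setTE aG _ _).1 sj c Ac cu).
have sf : smooth_near (y0, g y0) f by rewrite gy0.
(* On G_x near the unit, [A] is the constant F(1_x), [A1] is theta and [A2] is theta o inv; unlike
   the products they replace, all three are smooth near 1_x in the arrow space. *)
pose A h := Phi (h, inv h).
pose A1 h := Phi (h, u x).
pose A2 h := Phi (u x, inv h).
have gK : \forall y \near y0, cbwd c (g y) = inv (cbwd c y).
  apply: filterS (near_cbwd aG Ac cu ci) => y [_ iy _].
  exact: (cfwdK aG Ac iy).
have nA : \forall y \near y0, f (y, g y) = (A \o cbwd c) y.
  by apply: filterS gK => y gy; rewrite /f /A /= gy.
have nA1 : (fun y => f (y, g y0)) = A1 \o cbwd c.
  by apply/funext => y; rewrite /f /A1 /= gy0 y0K.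
have nA2 : \forall y \near y0, f (y0, g y) = (A2 \o cbwd c) y.
  by apply: filterS gK => y gy; rewrite /f /A2 /= gy y0K.
(* Only smoothness is extracted here, hence the arbitrary direction 0; the derivative along the
   components of v comes with [vA]. *)
have [sp _] := derive_pair_comp 0 sf sg.
have sA : smooth_at AG setT (u x) A.
  apply: smooth_at_ext (smooth_at_chart aG Ac cu sp).
  apply: filterS (filterI ci (nbhs_cdom aG Ac cu)) => h [ih ch] _.
  by rewrite /f /A /g /= (cfwdK aG Ac ch) (cfwdK aG Ac ih).
have sA1 : smooth_at AG setT (u x) A1.
  exact: smooth_at_slicel sPhi.
have sA2 : smooth_at AG setT (u x) A2.
  apply: (@smooth_map_comp _ _ _ _ _ _ _ inv (u x) (fun h => Phi (u x, h))
    (@inv_smooth _ _ _ G)).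
  by rewrite inv_unit; exact: smooth_at_slicer sPhi.
have vA : v A = v A1 + v A2.
  rewrite !(tangentE aG tv Ac cu)// -/y0.
  set w := chart_components v c.
  have [_ e] := derive_pair_comp w sf sg.
  by rewrite -(near_eq_derive _ nA) e nA1 (near_eq_derive _ nA2).
have sub H : smooth_at AG setT (u x) H -> smooth_at AG (isotropy x) (u x) H.
  exact: smooth_at_sub.
have vA0 : v A = 0.
  apply: (tangent_near_cst tv (a := F (u x))).
  have cp : {for u x, continuous (fun h => (h, inv h))}.
    by apply: continuous_pair; [exact: cvg_id|exact: inv_continuous].
  have nP : \forall h \near u x, P (h, inv h).
    by apply: cp; rewrite inv_unit.
  apply: filterS nP => h Ph [sh th].
  by rewrite /A -Ph /= ?tgt_inv// mul_invr th.
have vA1 : v theta = v A1.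
  symmetry; apply: (tangent_germ tv); first exact: sub.
  apply: filterS (filterI eF (near_pairl ePhi)) => h [eh ePh] ih.
  have [sh th] := ih.
  by rewrite eh// /A1 -ePh/= ?tgt_unit// -[X in unit_ X]sh mul_unitr.
have vA2 : v (theta \o inv) = v A2.
  symmetry; apply: (tangent_germ tv); first exact: sub.
  have nP : \forall h \near u x, P (u x, inv h) by exact: ninv (near_pairr ePhi).
  apply: filterS (filterI (ninv _ eF) nP) => h [eh ePh] [sh th].
  rewrite /= eh; last by rewrite /isotropy /= src_inv tgt_inv.
  rewrite /A2 -ePh /= ?tgt_inv ?src_unit// -[X in unit_ X]sh -tgt_inv.
  by rewrite mul_unitl.
by rewrite vA2 vA1; apply/eqP; rewrite -addr_eq0 addrC -vA vA0.
Qed.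

(** Evaluated at phi o t, the left-invariant term only sees t(1_x h^-1) = x and differentiates a
    constant; what remains of delta(alpha)(1_x) is the anchor. *)
Lemma delta0_anchor (alpha : sections G) x : algebroid_section alpha ->
  delta alpha = 0 -> anchor x (alpha x) = 0.
Proof.
move=> [/(_ x) ta _] d0; apply/funext => phi.
have [sphi|ns] := pselect (smooth_at AM setT x phi); last first.
  by rewrite /anchor dmap_nonsmoothE.
rewrite /anchor dmap_smoothE//.
have st : smooth_at AG setT (u x) (phi \o t).
  by apply: smooth_map_comp (@tgt_smooth _ _ _ G) _; rewrite tgt_unit.
have := deltaE_smooth alpha st; rewrite d0 src_unit tgt_unit.
rewrite [X in _ + X](tangent_near_cst ta (a := phi x)); last first.
  by near=> h => /= sh; rewrite tgt_mul ?tgt_unit// src_unit tgt_inv.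
rewrite addr0 => e.
transitivity (alpha x (fun h => (phi \o t) (mul h (u x)))); last exact: esym e.
apply: (tangent_germ ta).
  exact: smooth_at_sub st.
by near=> h => /= sh; rewrite tgt_mul// tgt_unit.
Unshelve. all: by end_near. Qed.

(** delta(alpha)(g) is tested on a smooth extension [Psi] of q |-> F(q g^-1), where F extends phi.
    As Psi(hg) = phi(h), the right-invariant term is alpha(t g)(phi); as Psi(gh) = phi(g h g^-1) for
    h in the isotropy group, the left-invariant term is minus the conjugate of v at phi, by
    [isotropy_tangent_inv]. *)
Lemma delta0_is_ad (alpha : sections G) g : algebroid_section alpha ->
  delta alpha = 0 -> is_ad g (alpha (s g)) (alpha (t g)).
Proof.
move=> sa d0; have [ta _] := sa.
have [v [tv iv]] := isotropy_lift sa (fun x => delta0_anchor x sa d0) (s g).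
exists v; split=> //; apply/funext => phi; rewrite /isotropy_incl.
have [sphi|ns] := pselect (smooth_at AG (sfiber (t g)) (u (t g)) phi);
  last first.
  by rewrite dmap_nonsmoothE//; have [/(_ phi ns) -> _ _ _] := ta (t g).
rewrite dmap_smoothE// /dconj dmap_smoothE; last first.
  by apply: smooth_at_sub sphi => h [].
rewrite -[LHS]/(v (fun h => phi (mul (mul g h) (inv g)))).
have [F [sF eF]] := smooth_at_extension aG sphi.
have sgi : s g = t (inv g) by rewrite tgt_inv.
have ggi : mul g (inv g) = u (t g) by exact: mul_invr.
have gu : mul g (u (s g)) = g by exact: mul_unitr.
have su : s g = t (u (s g)) by rewrite tgt_unit.
have tu : s (u (t g)) = t g by exact: src_unit.
have ug : mul (u (t g)) g = g by exact: mul_unitl.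
have s0 : smooth_at AG (sfiber (t (inv g))) g (fun h => F (mul h (inv g))).
  by apply: smooth_at_mulr => //; rewrite ggi.
have [Psi [sPsi ePsi]] := smooth_at_extension aG s0.
pose theta h := Psi (mul g h).
have sth : smooth_at AG (tfiber (s g)) (u (s g)) theta.
  by apply: smooth_at_mull; rewrite ?gu.
have sth' : smooth_at AG (isotropy (s g)) (u (s g)) theta.
  by apply: smooth_at_sub sth => h [].
have e1 : v (fun h => phi (mul (mul g h) (inv g))) = v theta.
  symmetry; apply: (tangent_germ tv) => //.
  pose Q1 := [set q : Ar | sfiber (t (inv g)) q -> F (mul q (inv g)) = Psi q].
  pose Q2 := [set q : Ar | sfiber (t g) q -> phi q = F q].
  (* [Q3] is a neighbourhood of g on which right translation by g^-1 lands where phi and F agree;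
     pulled back by h |-> gh, it handles the two-sided product g h g^-1 one translation at a
     time. *)
  pose Q3 := [set q : Ar | sfiber (t (inv g)) q -> Q2 (mul q (inv g))].
  have nQ1 : nbhs (mul g (u (s g))) Q1 by rewrite gu.
  have nQ2 : nbhs (mul g (inv g)) Q2 by rewrite ggi.
  have nQ3 : nbhs (mul g (u (s g))) Q3 by rewrite gu; exact: mulr_near sgi nQ2.
  have n1 := mull_near su nQ1; have n2 := mull_near su nQ3.
  apply: filterS (filterI n1 n2) => h [h1 h2] [sh th].
  have gh : s g = t h by [].
  have sgh : s (mul g h) = s g by rewrite src_mul.
  have thf : tfiber (s g) h by [].
  have sgh' : sfiber (t (inv g)) (mul g h) by rewrite /sfiber /= tgt_inv.
  rewrite /theta -(h1 thf sgh') -(h2 thf sgh')//.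
  by rewrite /sfiber /= src_mul ?src_inv// tgt_inv.
have e2 : alpha (t g) (fun h => Psi (mul h g)) = alpha (t g) phi.
  symmetry; apply: (tangent_germ (ta (t g))) => //.
  pose Q := [set q : Ar | sfiber (t (inv g)) q -> F (mul q (inv g)) = Psi q].
  have nQ : nbhs (mul (u (t g)) g) Q by rewrite ug.
  have n1 := mulr_near tu nQ.
  apply: filterS (filterI n1 eF) => h [h1 h2] sh.
  rewrite h2// -h1//; last by rewrite /sfiber /= src_mul// tgt_inv.
  by rewrite mulKV.
have e3 : alpha (s g) (fun h => Psi (mul g (inv h))) = - v theta.
  rewrite -(isotropy_tangent_inv tv sth') -iv /isotropy_incl dmap_smoothE//.
  apply: (@smooth_at_inv _ (tfiber (s g)) _ theta); last by rewrite inv_unit.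
  by move=> q; rewrite /tfiber /= tgt_inv.
have := deltaE_smooth alpha sPsi; rewrite d0 e2 e3 e1 => /esym/eqP.
by rewrite subr_eq0 => /eqP.
Qed.

(** Since (g h g^-1) g = g h, invariance rewrites the right-invariant term as v applied to h |->
    phi(gh), and the left-invariant term is its opposite because inversion acts as -1 on v. *)
Lemma isotropy_delta0 (alpha : sections G) :
  algebroid_section alpha ->
  (forall g, is_ad g (alpha (s g)) (alpha (t g))) -> delta alpha = 0.
Proof.
move=> sa ad; apply/funext => g; apply/funext => phi.
have [sphi|ns] := pselect (smooth_at AG setT g phi); last first.
  exact: delta_nonsmooth.
rewrite deltaE_smooth//.
have [v [tv iv cv]] := ad g.
have gu : mul g (u (s g)) = g by exact: mul_unitr.
have ug : mul (u (t g)) g = g by exact: mul_unitl.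
have su : s g = t (u (s g)) by rewrite tgt_unit.
have tu : s (u (t g)) = t g by exact: src_unit.
pose theta h := phi (mul g h).
have sth : smooth_at AG (tfiber (s g)) (u (s g)) theta.
  by apply: smooth_at_mull; rewrite ?gu.
have sth' : smooth_at AG (isotropy (s g)) (u (s g)) theta.
  by apply: smooth_at_sub sth => h [].
have s1 : smooth_at AG (sfiber (t g)) (u (t g)) (fun h => phi (mul h g)).
  by apply: smooth_at_mulr; rewrite ?ug.
have -> : alpha (t g) (fun h => phi (mul h g)) = v theta.
  rewrite -cv /isotropy_incl /dconj !dmap_smoothE//; last first.
    by apply: smooth_at_sub s1 => h [].
  symmetry; apply: (tangent_germ tv) => //.
  near=> h => -[sh th] /=.
  by rewrite mulVK// src_mul.
have -> : alpha (s g) (fun h => phi (mul g (inv h))) = - v theta.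
  rewrite -(isotropy_tangent_inv tv sth') -iv /isotropy_incl dmap_smoothE//.
  apply: (@smooth_at_inv _ (tfiber (s g)) _ theta); last by rewrite inv_unit.
  by move=> q; rewrite /tfiber /= tgt_inv.
by rewrite subrr.
Unshelve. all: by end_near. Qed.

End Groupoid.

Lemma H0def_predE {R : realType} {n k : nat} (G : lie_groupoid R n k)
    (alpha : sections G) : H0def_pred alpha = H0isotropy_pred alpha.
Proof.
apply/asboolP/asboolP => [[sa d0]|[[sa r0] ad]].
  split; first by split=> // x; exact: delta0_anchor.
  by move=> g; exact: delta0_is_ad.
by split=> //; exact: isotropy_delta0.
Qed.

(* The isomorphism is the identity on the underlying sections of A. *)
Theorem proposition4p1 (R : realType) (n k : nat) (G : lie_groupoid R n k) :
  exists f : {linear H0def G -> H0isotropy G},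
    bijective f /\ forall alpha : H0def G, f alpha = alpha :> sections G.
Proof.
have toI (a : H0def G) : H0isotropy_pred (a : sections G).
  by rewrite -H0def_predE; exact: (valP a).
have toD (b : H0isotropy G) : H0def_pred (b : sections G).
  by rewrite H0def_predE; exact: (valP b).
pose f (a : H0def G) : H0isotropy G := MkH0isotropy (toI a).
pose g (b : H0isotropy G) : H0def G := MkH0def (toD b).
have lf : linear f by move=> c a b; exact: val_inj.
pose F : {linear H0def G -> H0isotropy G} :=
  HB.pack f (GRing.isLinear.Build _ _ _ _ f lf).
exists F; split=> //; exists g => x; exact: val_inj.
Qed.
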